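(* Let $X_1,\dots,X_r$ be uniformly nonsquare Banach spaces and let $\|\cdot\|_\psi$ be an absolute normalized norm on $\mathbb{R}^r$ which is strictly monotone. Then the direct sum $(X_1\oplus\dots\oplus X_r)_\psi$ has the fixed point property and the super fixed point property for asymptotically nonexpansive mappings in the intermediate sense. If $r=2$, the same conclusion holds for every absolute normalized norm $\|\cdot\|_\psi$ on $\mathbb{R}^2$ (without assuming strict monotonicity).
   Context: A Banach space $X$ is uniformly nonsquare if $\sup_{x,y\in S_X}\min\{\|x+y\|,\|x-y\|\}<2$. A norm on $\mathbb{R}^r$ is absolute if $\|(x_1,\dots,x_r)\|=\|(|x_1|,\dots,|x_r|)\|$, normalized if standard unit vectors have norm 1, strictly monotone if $\|(x_i)\|<\|(y_i)\|$ whenever $|x_i|\le|y_i|$ for all $i$ with strict inequality for some $i$. $(X_1\oplus\dots\oplus X_r)_\psi$ is $X_1\times\dots\times X_r$ with norm $\|(x_1,\dots,x_r)\|_\psi=\|(\|x_1\|,\dots,\|x_r\|)\|_\psi$. A mapping $T:C\to C$ is asymptotically nonexpansive in the intermediate sense if $T$ is continuous and $\limsup_{n\to\infty}\sup_{x,y\in C}(\|T^nx-T^ny\|-\|x-y\|)\le0$. A Banach space has the fixed point property for such mappings if every such $T:C\to C$ on a nonempty bounded closed convex subset $C$ has a fixed point; $X$ has the super fixed point property for such mappings if every Banach space finitely representable in $X$ has the fixed point property for such mappings. *)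

(* Defs.v *)
From HB Require Import structures.
From mathcomp Require Import all_boot all_order all_algebra.
From mathcomp Require Import all_classical all_reals.
From mathcomp Require Import topology normedtype.
Set Implicit Arguments. Unset Strict Implicit. Unset Printing Implicit Defensive.
Import Order.TTheory GRing.Theory Num.Theory.
Import numFieldNormedType.Exports.
Local Open Scope classical_set_scope.
Local Open Scope ring_scope.

(* A real vector space presented by its operations, together with a norm
   function.  Used uniformly both for Banach spaces and for the
   psi-direct sum (X_1 (+) ... (+) X_r)_psi. *)
Record nspace (R : realType) := NSpace {
  ns_car :> Type;
  ns_add : ns_car -> ns_car -> ns_car;
  ns_scale : R -> ns_car -> ns_car;
  ns_norm : ns_car -> R }.

Section NSpaceDefs.
Variables (R : realType) (V : nspace R).

Definition ns_sub (x y : V) : V := ns_add x (ns_scale (-1) y).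
Definition ns_dist (x y : V) : R := ns_norm (ns_sub x y).

Definition ns_bounded (C : set V) : Prop :=
  exists M : R, forall x, C x -> ns_norm x <= M.

Definition ns_closed (C : set V) : Prop :=
  forall (u : nat -> V) (x : V), (forall n, C (u n)) ->
    (forall e : R, 0 < e -> exists N : nat, forall n, (N <= n)%N -> ns_dist (u n) x < e) ->
    C x.

Definition ns_convex (C : set V) : Prop :=
  forall x y (t : R), C x -> C y -> 0 <= t -> t <= 1 ->
    C (ns_add (ns_scale t x) (ns_scale (1 - t) y)).

(* T : C -> C is asymptotically nonexpansive in the intermediate sense:
   T maps C into C, T is continuous on C, and
   limsup_n sup_{x,y in C} (|T^n x - T^n y| - |x - y|) <= 0. *)
Definition ns_ani (C : set V) (T : V -> V) : Prop :=
  (forall x, C x -> C (T x)) /\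
  (forall x, C x -> forall e : R, 0 < e -> exists2 d : R, 0 < d &
     forall y, C y -> ns_dist y x < d -> ns_dist (T y) (T x) < e) /\
  (forall e : R, 0 < e -> exists N : nat, forall n, (N <= n)%N ->
     forall x y, C x -> C y ->
       ns_dist (iter n T x) (iter n T y) - ns_dist x y <= e).

Definition ns_fpp_ani : Prop :=
  forall (C : set V) (T : V -> V),
    C !=set0 -> ns_bounded C -> ns_closed C -> ns_convex C -> ns_ani C T ->
    exists2 x, C x & T x = x.

End NSpaceDefs.

Definition nspace_of (R : realType) (X : normedModType R) : nspace R :=
  @NSpace R X (fun x y => x + y) (fun a x => a *: x) (fun x => `|x|).

(* Y is finitely representable in V: for every finite-dimensional subspace
   F of Y (= span of finitely many vectors) and every e > 0 there is a
   linear injection T : F -> V with |T| |T^-1| <= 1 + e. *)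
Definition span_of (R : realType) (Y : normedModType R) (n : nat) (y : 'I_n -> Y) : set Y :=
  [set z | exists a : 'I_n -> R, z = \sum_(i < n) a i *: y i].

Definition finitely_representable (R : realType) (Y : normedModType R) (V : nspace R) : Prop :=
  forall (n : nat) (y : 'I_n -> Y) (e : R), 0 < e ->
    exists (T : Y -> V) (c d : R),
      [/\ forall (a : R) (z w : Y), span_of y z -> span_of y w ->
            T (a *: z + w) = ns_add (ns_scale a (T z)) (T w),
          0 < c, 0 < d, c * d <= 1 + e &
          forall z, span_of y z -> ns_norm (T z) <= c * `|z| /\ `|z| <= d * ns_norm (T z)].

Definition ns_super_fpp_ani (R : realType) (V : nspace R) : Prop :=
  forall Y : completeNormedModType R,
    finitely_representable Y V -> ns_fpp_ani (nspace_of Y).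

Definition uniformly_nonsquare (R : realType) (X : normedModType R) : Prop :=
  exists2 delta : R, 0 < delta &
    forall x y : X, `|x| = 1 -> `|y| = 1 -> Num.min `|x + y| `|x - y| <= 2 - delta.

Definition is_norm_Rn (R : realType) (r : nat) (psi : ('I_r -> R) -> R) : Prop :=
  [/\ forall x, psi x = 0 -> x = (fun _ => 0),
      forall (a : R) x, psi (fun i => a * x i) = `|a| * psi x &
      forall x y, psi (fun i => x i + y i) <= psi x + psi y].

Definition absolute_Rn (R : realType) (r : nat) (psi : ('I_r -> R) -> R) : Prop :=
  forall x, psi x = psi (fun i => `|x i|).

Definition normalized_Rn (R : realType) (r : nat) (psi : ('I_r -> R) -> R) : Prop :=
  forall i : 'I_r, psi (fun j => (j == i)%:R) = 1.

Definition strictly_monotone_Rn (R : realType) (r : nat) (psi : ('I_r -> R) -> R) : Prop :=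
  forall x y, (forall i, `|x i| <= `|y i|) -> (exists i, `|x i| < `|y i|) -> psi x < psi y.

Definition psi_sum (R : realType) (r : nat) (X : 'I_r -> normedModType R)
    (psi : ('I_r -> R) -> R) : nspace R :=
  @NSpace R (forall i, X i) (fun x y i => x i + y i) (fun a x i => a *: x i)
    (fun x => psi (fun i => `|x i|)).

(* Main.v *)
(* Everything is done for a seminorm N controlled by nonsquare seminorms p_1, ..., p_r;
   the space finitely representable in the direct sum inherits such a structure by
   taking limits of the coordinates along an ultrafilter.

   James' argument (alternating sums x, y stretched against each other, so that both
   (x + y)/2 and (x - y)/2 alternate again) shows that in a nonsquare seminorm the
   averages of long generic subsequences of a bounded sequence get close to each other.
   Hence generic averages converge in N, and these limits replace weak limits.

   For a family of nonexpansive maps take a minimal invariant convex set K, approximate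
   common fixed points x_a in K at constant distance c from all points of K (along an
   ultrafilter), and the limit z of their averages.  Choose more than 2^r distinct
   weights t_1, t_2, ... of sum 1 and move sum_i t_i x_{a_i} to an approximate fixed point w
   by a nonexpansive map Psi of K almost fixing the x_a; then N(w - z) is almost c.  Letting only
   the index a_i vary, the mean v of the w's satisfies N(v - z) <= (1 - t_i) c, while two of
   the w's differ by at most t_i c.  As w - z is almost a mean of (v - z) + (w - w'),
   and nonsquareness applies to (v - z) + (w - w') and (v - z) - (w - w') in each
   coordinate, the coordinates split into those carried by w - w' and those carried
   by v - z.  So for a functional norming w - z, the mass t_i c sits on some set D_i of
   coordinates; two of the D_i coincide although the t_i differ, whence c = 0.

   Bruck's retraction argument passes from one map to finite commuting families, and
   the same minimal set argument to arbitrary ones.  If T is asymptotically nonexpansive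
   in the intermediate sense, the maps T^phi(n), phi(n) -> oo, are commuting and
   nonexpansive on the ultrapower; their common fixed points are sequences almost fixed by
   all large powers of T, and can be refined to a sequence converging to a fixed point. *)
Require Import Defs.
From HB Require Import structures.
From mathcomp Require Import all_boot all_order all_algebra.
From mathcomp Require Import all_classical all_reals.
From mathcomp Require Import topology normedtype.
From mathcomp Require Import ring lra zify.
Set Implicit Arguments. Unset Strict Implicit. Unset Printing Implicit Defensive.
Import Order.TTheory GRing.Theory Num.Theory.
Import numFieldNormedType.Exports.
Local Open Scope classical_set_scope.
Local Open Scope ring_scope.

(** * Generic finite sequences along an ultrafilter *)
Section Generic.
Variables (R : realType) (I : Type) (U : set_system I).

(* For U-almost all a1, for U-almost all a2, ..., P [:: a1; a2; ...; ak]. *)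
Fixpoint generic (k : nat) (P : seq I -> Prop) : Prop :=
  if k is k'.+1 then U [set a | generic k' (fun s => P (a :: s))] else P [::].

Context {FU : UltraFilter U}.

Lemma genericS k (P Q : seq I -> Prop) :
  (forall s, size s = k -> P s -> Q s) -> generic k P -> generic k Q.
Proof.
elim: k P Q => [|k IH] P Q PQ /=; first by apply: PQ.
apply: filterS => a /=; apply: IH => s sk; apply: PQ => /=; by rewrite sk.
Qed.

Lemma genericT k (P : seq I -> Prop) :
  (forall s, size s = k -> P s) -> generic k P.
Proof.
elim: k P => [|k IH] P Ps /=; first by apply: Ps.
by apply: filterE => a /=; apply: IH => s sk; apply: Ps; rewrite /= sk.
Qed.

Lemma genericI k (P Q : seq I -> Prop) :
  generic k P -> generic k Q -> generic k (fun s => P s /\ Q s).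
Proof.
elim: k P Q => [|k IH] P Q //= HP HQ.
by apply: filterS2 HP HQ => a /=; exact: IH.
Qed.

Lemma generic_forall (J : finType) k (P : J -> seq I -> Prop) :
  (forall j, generic k (P j)) -> generic k (fun s => forall j, P j s).
Proof.
move=> HP.
suff : generic k (fun s => forall j, j \in enum J -> P j s).
  by apply: genericS => s _ H j; apply: H; rewrite mem_enum.
elim: (enum J) => [|j l IH]; first exact: genericT.
apply: genericS (genericI (HP j) IH) => s _ [Pj Pl] i.
by rewrite inE => /orP[/eqP -> //|]; exact: Pl.
Qed.

Lemma generic_ex k (P : seq I -> Prop) :
  generic k P -> exists2 s, size s = k & P s.
Proof.
elim: k P => [|k IH] P /=; first by exists [::].
by move=> /filter_ex[a /= /IH[s sk Ps]]; exists (a :: s); rewrite //= sk.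
Qed.

Lemma genericN k (P : seq I -> Prop) :
  ~ generic k P -> generic k (fun s => ~ P s).
Proof.
elim: k P => [|k IH] P //= nP.
have [//|] := in_ultra_setVsetC [set a | generic k (fun s => P (a :: s))] FU.
by apply: filterS => a /= /IH.
Qed.

Lemma generic_cat k l (P : seq I -> Prop) :
  generic (k + l) P <->
  generic k (fun s => generic l (fun s' => P (s ++ s'))).
Proof.
elim: k P => [|k IH] P; first by [].
rewrite addSn /=; split; apply: filterS => a /=;
  by case: (IH (fun s => P (a :: s))).
Qed.

(** Entries that the mask drops are quantified vacuously, so a subsequence at fixed positions of a
    generic sequence is itself generic. *)
Lemma generic_mask m (P : seq I -> Prop) :
  generic (count id m) P -> generic (size m) (fun s => P (mask m s)).
Proof.
elim: m P => [|[] m IH] P //=; rewrite ?add1n ?add0n.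
  by apply: filterS => a /=; exact: IH.
by move=> HP; apply: filterE => a /=; exact: IH.
Qed.

Lemma generic_all k (Q : pred I) : U [set a | Q a] -> generic k (all Q).
Proof.
move=> UQ; elim: k => [//|k IH] /=; apply: filterS UQ => a /= Qa.
by apply: genericS IH => s _ ->; rewrite Qa.
Qed.

Lemma generic_window l N i (P : seq I -> Prop) : (i + l <= N)%N ->
  generic l P -> generic N (fun s => P (take l (drop i s))).
Proof.
move=> ilN HP.
have := @generic_mask (nseq i false ++ nseq l true ++ nseq (N - i - l) false) P.
rewrite !count_cat !count_nseq /= mul1n !mul0n add0n addn0 => /(_ HP).
rewrite !size_cat !size_nseq (_ : (i + _)%N = N); last lia.
apply: genericS => s sN.
suff -> : mask (nseq i false ++ nseq l true ++ nseq (N - i - l) false) s =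
  take l (drop i s) by [].
rewrite -{1}(cat_take_drop i s) mask_cat ?size_nseq ?size_takel; try lia.
rewrite mask_false /= -{1}(cat_take_drop l (drop i s)).
rewrite mask_cat ?size_nseq ?size_takel ?size_drop; try lia.
by rewrite mask_false cats0 mask_true // size_takel // size_drop; lia.
Qed.

Lemma generic_nth (a0 : I) (P : I -> Prop) k i : (i < k)%N ->
  U [set a | P a] -> generic k (fun s => P (nth a0 s i)).
Proof.
elim: k i => [//|k IH] [|i] /= ik HP.
  by apply: filterS HP => a /= Pa; exact: genericT.
by apply: filterE => a /=; exact: IH.
Qed.

Lemma generic_pairwise k (r : rel I) :
  U [set a | U [set b | r a b]] -> generic k (fun s => pairwise r s).
Proof.
move=> Hr; elim: k => [//|k IH] /=; apply: filterS Hr => a /= Ha.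
suff : generic k (fun s => all (r a) s).
  by move=> H; apply: genericS (genericI H IH) => s _ [-> ->].
elim: {IH} k => [//|k IH] /=; apply: filterS Ha => b /= rab.
by apply: genericS IH => s _ ->; rewrite rab.
Qed.

(** The limit is the supremum of the levels lying below [f] almost everywhere; an ultrafilter
    decides for each level whether it does. *)
Lemma ultra_lim (f : I -> R) (B : R) : U [set i | `|f i| <= B] ->
  exists2 l, `|l| <= B & forall e, 0 < e -> U [set i | `|f i - l| < e].
Proof.
move=> fB; pose S := [set t | U [set i | t <= f i]].
have SB : S (- B) by apply: filterS fB => i /=; rewrite ler_norml => /andP[].
have Sub t : S t -> t <= B.
  move=> St; have [i [/= ti]] := filter_ex (filterI St fB).
  by rewrite ler_norml => /andP[_]; exact: le_trans.
have hS : has_sup S by split; [exists (- B)|exists B => t /Sub].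
exists (sup S).
  rewrite ler_norml; apply/andP; split; first by apply: ub_le_sup => //; exact: hS.2.
  by apply: ge_sup; [exists (- B)|exact: Sub].
move=> e e0.
have [t St lt] := sup_adherent e0 hS.
have nS : ~ S (sup S + e).
  move=> H; have := ub_le_sup hS.2 H; rewrite gerDl leNgt e0 //.
have [//|H] := in_ultra_setVsetC [set i | sup S + e <= f i] FU.
apply: filterS2 St H => i /= ti /negP; rewrite -ltNge => fi.
rewrite ltr_norml; lra.
Qed.

Lemma generic_lim k (f : seq I -> R) (B : R) :
  generic k (fun s => `|f s| <= B) ->
  exists2 l, `|l| <= B & forall e, 0 < e -> generic k (fun s => `|f s - l| < e).
Proof.
elim: k f => [|k IH] f /= fB.
  by exists (f [::]) => // e e0; rewrite subrr normr0.
(* The inner iterated limit with first index [a]; the default 0 matters only on a null set of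
   [a]. *)
pose g a := xget 0 [set l | `|l| <= B /\ forall e, 0 < e ->
   generic k (fun s => `|f (a :: s) - l| < e)].
have gP : U [set a | `|g a| <= B /\ forall e, 0 < e ->
   generic k (fun s => `|f (a :: s) - g a| < e)].
  apply: filterS fB => a /= /IH[l lB lP].
  exact: (xgetI 0 (P := [set l | `|l| <= B /\ forall e, 0 < e ->
    generic k (fun s => `|f (a :: s) - l| < e)]) (conj lB lP)).
have [|l lB lP] := @ultra_lim g B; first by apply: filterS gP => a [].
exists l => // e e0.
have e2 : 0 < e / 2 by rewrite divr_gt0.
apply: filterS2 gP (lP _ e2) => a /= [_ ga] gl.
apply: genericS (ga _ e2) => s _ fg.
have := ler_distD (g a) (f (a :: s)) l; lra.
Qed.

End Generic.

(** * Seminorms *)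

Record seminorm (R : realType) (E : lmodType R) := Seminorm {
  sn :> E -> R;
  snD : forall x y, sn (x + y) <= sn x + sn y;
  snZ : forall a x, sn (a *: x) = `|a| * sn x }.

Section SeminormTheory.
Variables (R : realType) (E : lmodType R) (p : seminorm E).
Implicit Types x y z : E.

Lemma sn0 : p 0 = 0.
Proof. by rewrite -(scale0r (0 : E)) snZ normr0 mul0r. Qed.

Lemma snN x : p (- x) = p x.
Proof. by rewrite -scaleN1r snZ normrN1 mul1r. Qed.

Lemma sn_ge0 x : 0 <= p x.
Proof. by have := snD p x (- x); rewrite subrr sn0 snN; lra. Qed.

Lemma sn_distC x y : p (x - y) = p (y - x).
Proof. by rewrite -snN opprB. Qed.

Lemma sn_distD z x y : p (x - y) <= p (x - z) + p (z - y).
Proof. by rewrite -{1}(subrK z x) -addrA; exact: snD. Qed.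

Lemma snB x y : p (x - y) <= p x + p y.
Proof. by rewrite (le_trans (snD _ _ _)) // snN. Qed.

Lemma sn_sum (J : Type) (l : seq J) (P : pred J) (F : J -> E) :
  p (\sum_(j <- l | P j) F j) <= \sum_(j <- l | P j) p (F j).
Proof.
elim/big_rec2 : _ => [|j a b _ H]; first by rewrite sn0.
by rewrite (le_trans (snD _ _ _)) // lerD2l.
Qed.

Lemma snZ_ge0 a x : 0 <= a -> p (a *: x) = a * p x.
Proof. by move=> a0; rewrite snZ ger0_norm. Qed.

Lemma sn_sumZ (J : Type) (l : seq J) (P : pred J) (a : J -> R) (F : J -> E) :
  (forall j, 0 <= a j) ->
  p (\sum_(j <- l | P j) a j *: F j) <= \sum_(j <- l | P j) a j * p (F j).
Proof.
move=> a0; rewrite (le_trans (sn_sum _ _ _)) // ler_sum // => j _.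
by rewrite snZ_ge0.
Qed.

End SeminormTheory.

(* Homogeneous form of uniform nonsquareness; it passes to ultraproducts. *)
Definition nonsquare (R : realType) (E : lmodType R) (k : R) (p : E -> R) :=
  forall x y, Num.min (p (x + y)) (p (x - y)) <= p x + p y - k * Num.min (p x) (p y).

(** * Linear combinations along index lists and James' alternating sums *)

Section Lincomb.
Variables (R : realType) (E : lmodType R) (I : Type) (x : I -> E).
Implicit Types (a b c h : seq R) (s : seq I).

(** Surplus entries of the longer list are ignored, so [a] can be tested on any long enough index
    list. *)
Fixpoint lincomb a s : E :=
  match a, s with
  | t :: a', i :: s' => t *: x i + lincomb a' s'
  | _, _ => 0
  end.

Definition average s : E := (size s)%:R^-1 *: \sum_(i <- s) x i.

Lemma lincomb_cat a b s s' : size a = size s ->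
  lincomb (a ++ b) (s ++ s') = lincomb a s + lincomb b s'.
Proof.
elim: a s => [|t a IH] [|i s] //=; first by rewrite add0r.
by case=> /IH ->; rewrite addrA.
Qed.

Lemma lincombZ t a s : lincomb (map ( *%R t) a) s = t *: lincomb a s.
Proof.
elim: a s => [|u a IH] [|i s] //=; rewrite ?scaler0 //.
by rewrite IH scalerDr scalerA.
Qed.

(* Starting from sg, the partial sums of a pass through the n values v, -v, v, ...
   in this order and end at 0. *)
Fixpoint wave n (v sg : R) a : Prop :=
  if n is n'.+1
  then exists a1 a2, [/\ a = a1 ++ a2, sg + \sum_(t <- a1) t = v & wave n' (- v) v a2]
  else sg + \sum_(t <- a) t = 0.

Lemma wave_prepend n v sg sg' h a :
  wave n v sg a -> sg' + \sum_(t <- h) t = sg -> wave n v sg' (h ++ a).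
Proof.
case: n => [|n] /= Ha hs; first by rewrite big_cat /= addrA hs.
case: Ha => a1 [a2 [-> a1v wa2]]; exists (h ++ a1), a2.
by rewrite catA big_cat /= addrA hs.
Qed.

(** One coefficient per jump, each of size at most 2: the total grows only linearly in [n]. *)
Lemma wave_exists n v sg : `|v| <= 1 -> `|sg| <= 1 ->
  exists2 a, wave n v sg a & \sum_(t <- a) `|t| <= n.+1%:R * 2.
Proof.
elim: n v sg => [|n IH] v sg v1 s1.
  exists [:: - sg]; rewrite /= big_seq1 ?subrr // normrN; lra.
have [||a wa an] := IH (- v) v; rewrite ?normrN //.
exists ((v - sg) :: a).
  by exists [:: v - sg], a; split => //; rewrite big_seq1; lra.
rewrite big_cons -natr1.
have := ler_normB v sg; lra.
Qed.

(* Two copies of a stretched along a longer index list; b and c are half their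
   sum and half their difference. *)
Definition doubling a (m1 m2 : bitseq) b c :=
  [/\ size m2 = size m1, size b = size m1, size c = size m1,
      count id m1 = size a & count id m2 = size a] /\
  forall s, size s = size m1 ->
    lincomb a (mask m2 s) + lincomb a (mask m1 s) = 2 *: lincomb b s /\
    lincomb a (mask m2 s) - lincomb a (mask m1 s) = 2 *: lincomb c s.

(** The block [a] is placed on two adjacent stretches of indices, first by [m1], then by [m2]. Half
    the sum reads [h], [h] there, and half the difference reads [-h], [h]. *)
Lemma doubling_cat a a' m1 m2 b c (h := map ( *%R 2^-1) a) (k := size a) :
  doubling a' m1 m2 b c ->
  doubling (a ++ a') (nseq k true ++ nseq k false ++ m1)
    (nseq k false ++ nseq k true ++ m2) (h ++ h ++ b) (map ( *%R (- 1)) h ++ h ++ c).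
Proof.
case=> -[m2m bm cm c1 c2] Hs; split.
  rewrite !(size_cat, size_map, size_nseq, count_cat, count_nseq) /=.
  by rewrite m2m bm cm c1 c2 !(mul1n, mul0n, add0n).
move=> s; rewrite !size_cat !size_nseq => ss.
have [s1 [s2 [s3 [-> s1k s2k s3k]]]] : exists s1 s2 s3,
    [/\ s = s1 ++ s2 ++ s3, size s1 = k, size s2 = k & size s3 = size m1].
  exists (take k s), (take k (drop k s)), (drop k (drop k s)).
  rewrite !cat_take_drop !size_takel ?size_drop; first split => //; lia.
rewrite !mask_cat ?size_nseq //.
rewrite !mask_false !(mask_true (n := k)) ?s1k ?s2k //=.
have hk : size h = k by rewrite size_map.
rewrite !lincomb_cat ?size_map ?hk ?s1k ?s2k // !lincombZ.
have [H1 H2] := Hs s3 s3k.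
have half (v : E) : v = 2 *: (2^-1 *: v) by rewrite scalerA mulfV ?pnatr_eq0 // scale1r.
rewrite scaleN1r; set u := lincomb a s1; set v := lincomb a s2.
rewrite !scalerDr -H1 -H2 scalerN -!half; split.
  by rewrite addrACA (addrC v) -addrA.
by rewrite opprD addrACA (addrC v) -addrA.
Qed.

(** In [b] each jump is made in two halves, so the same values are passed. In [c] the partial sums
    leave 0 by minus half of each jump and return; half a jump between [v] and [-v] is again [v] or
    [-v], so [c] alternates too. Only the first jump, if it does not start at [-v], may be too
    short, which costs one value. *)
Lemma doubling_wave n v sg a : wave n v sg a -> exists m1 m2 b c,
  [/\ doubling a m1 m2 b c, wave n v sg b,
      (sg = - v -> wave n (- v) 0 c) &
      if n is n'.+1 then wave n' v 0 c else True].
Proof.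
have D0 : doubling [::] [::] [::] [::] [::].
  by split => // -[|//] _ /=; rewrite subr0 addr0 scaler0.
have sumZ t b : \sum_(u <- map ( *%R t) b) u = t * \sum_(u <- b) u.
  by rewrite big_map mulr_sumr.
elim: n v sg a => [|n IH] v sg a /=.
  move=> Ha; have := doubling_cat a D0; rewrite !cats0.
  set m1 := _ ++ _; set m2 := _ ++ _; set b := _ ++ _; set c := _ ++ _ => D.
  exists m1, m2, b, c; split => //; rewrite /b /c !big_cat /= !sumZ; first lra.
  by move=> _; lra.
move=> [a1 [a2 [-> a1v /IH[m1 [m2 [b [c [D wb wc _]]]]]]]].
have {}wc := wc (esym (opprK v)); rewrite opprK in wc.
set h := map ( *%R 2^-1) a1.
have hs : \sum_(t <- h) t = (v - sg) / 2 by rewrite sumZ -a1v; lra.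
have hs' : \sum_(t <- map ( *%R (-1)) h) t = - ((v - sg) / 2).
  by rewrite sumZ hs; lra.
do 4 eexists; split; first exact: doubling_cat D.
- by exists (h ++ h), b; rewrite catA big_cat /= hs; split => //; lra.
- move=> sgv; exists (map ( *%R (-1)) h), (h ++ c); split => //.
    by rewrite hs' sgv; lra.
  by rewrite opprK; apply: wave_prepend wc _; rewrite hs sgv; lra.
- rewrite catA; apply: wave_prepend wc _.
  by rewrite big_cat /= hs hs'; lra.
Qed.

Lemma lincomb_le (p : seminorm E) (B : R) a s : 0 <= B ->
  all (fun i => p (x i) <= B) s -> p (lincomb a s) <= B * \sum_(t <- a) `|t|.
Proof.
move=> B0; elim: a s => [|t a IH] [|i s] /=; rewrite ?sn0 ?big_nil ?mulr0 //.
  by move=> _; rewrite mulr_ge0 // sumr_ge0.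
move=> /andP[iB /IH H]; rewrite big_cons mulrDr (le_trans (snD _ _ _)) //.
by rewrite lerD // snZ mulrC ler_wpM2r.
Qed.

(* The point is that the boundary term does not depend on M. *)
Lemma sum_translates (p : seminorm E) (B : R) (i0 : I) M a s : 0 <= B ->
  all (fun i => p (x i) <= B) s -> (M + size a <= size s)%N ->
  p (\sum_(i < M) lincomb a (drop i s)
     - (\sum_(t <- a) t) *: \sum_(i < M) x (nth i0 s i))
  <= 2 * B * (size a)%:R * \sum_(t <- a) `|t|.
Proof.
move=> B0; elim: a s => [|t a IH] s sB Ms.
  by rewrite !big_nil scale0r subr0 mulr0 big1 ?sn0.
case: s sB Ms => [|i s]; first by rewrite addnS.
rewrite [all _ _]/= -[size (t :: a)]/(size a).+1 -[size (i :: s)]/(size s).+1.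
move=> /andP[iB sB]; rewrite addnS ltnS => Ms.
have -> : \sum_(j < M) lincomb (t :: a) (drop j (i :: s)) =
    t *: \sum_(j < M) x (nth i0 (i :: s) j) + \sum_(j < M) lincomb a (drop j s).
  rewrite scaler_sumr -big_split /=; apply: eq_bigr => j _.
  have jM : (j < size (i :: s))%N by rewrite /= (leq_trans (ltn_ord j)) // ltnW //; lia.
  by rewrite (drop_nth i0 jM).
(* Shifting the window by one place changes only its two ends. *)
have tel : \sum_(j < M) x (nth i0 s j) - \sum_(j < M) x (nth i0 (i :: s) j)
    = x (nth i0 (i :: s) M) - x i.
  rewrite -sumrB; elim: (M) => [|m IHm]; first by rewrite big_ord0 subrr.
  by rewrite big_ord_recr /= IHm addrC addrA subrK.
rewrite !big_cons scalerDl opprD addrACA addrA subrr add0r.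
set S := \sum_(j < M) x (nth i0 (i :: s) j); set S' := \sum_(j < M) x (nth i0 s j).
set A := \sum_(t <- a) t; set Q := \sum_(j < M) lincomb _ _.
rewrite -/S -/S' in tel.
have -> : Q - A *: S = (Q - A *: S') + A *: (S' - S).
  by rewrite scalerBr addrA subrK.
apply: le_trans (snD _ _ _) _.
have Aabs : `|A| <= \sum_(t <- a) `|t| by exact: ler_norm_sum.
have iM : p (x (nth i0 (i :: s) M)) <= B.
  have : all (fun i => p (x i) <= B) (i :: s) by rewrite /= iB sB.
  by move=> /all_nthP; apply; rewrite /=; lia.
have H2 : p (A *: (S' - S)) <= (\sum_(t <- a) `|t|) * (2 * B).
  rewrite snZ ler_pM ?sn_ge0 // tel (le_trans (snB _ _ _)) //; lra.
have H1 := IH s sB Ms; rewrite -/Q -/A -/S' in H1.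
apply: le_trans (lerD H1 H2) _.
rewrite -natr1; set n := (size a)%:R; set T := \sum_(_ <- _) _.
have : 0 <= 2 * B * (n + 1) * `|t| by rewrite !mulr_ge0 // addr_ge0 // ler0n.
by nra.
Qed.

End Lincomb.

(** * Averages in nonsquare spaces *)
Section BanachSaks.
Variables (R : realType) (E : lmodType R) (I : Type) (U : set_system I).
Context {FU : UltraFilter U}.
Variables (x : I -> E) (p : seminorm E) (k B : R).
Hypotheses (k0 : 0 < k) (k1 : k <= 1) (nsp : nonsquare k p).
Hypotheses (B0 : 0 <= B) (xB : U [set i | p (x i) <= B]).
Implicit Types (a b c : seq R) (s : seq I).

Let generic_bounded n := generic_all n xB.

Let spreading_spec a (l : R) := forall e : R, 0 < e ->
  generic U (size a) (fun s => `|p (lincomb x a s) - l| < e).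

(* The norm of the spreading model generated by x along U. *)
Let spreading a : R := xget 0 (spreading_spec a).

Let spreadingP a (e : R) : 0 < e ->
  generic U (size a) (fun s => `|p (lincomb x a s) - spreading a| < e).
Proof.
have [|l _ lP] := @generic_lim R _ U _ (size a) (fun s => p (lincomb x a s))
  (B * \sum_(t <- a) `|t|).
  apply: genericS (generic_bounded (size a)) => s _ sB.
  by rewrite ger0_norm ?sn_ge0 // lincomb_le.
exact: (xgetI 0 (P := spreading_spec a) lP).
Qed.

Let spreading_le a : spreading a <= B * \sum_(t <- a) `|t|.
Proof.
rewrite leNgt; apply/negP; rewrite -subr_gt0 => e0.
have [s _ [+ /(lincomb_le a B0)]] :=
  generic_ex (genericI (spreadingP a e0) (generic_bounded (size a))).
by rewrite ltr_norml; lra.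
Qed.

(** On a generic sequence both copies of [a] have norm near [spreading a], while their sum and
    difference are twice the combinations [b] and [c]; nonsquareness of [p] is applied to the
    copies. *)
Let spreading_nonsquare a m1 m2 b c : doubling x a m1 m2 b c ->
  2 * Num.min (spreading b) (spreading c) <= (2 - k) * spreading a.
Proof.
move=> [[sm2 sb sc cm1 cm2] Hs]; apply/ler_addgt0Pr => e e0.
have e4 : 0 < e / 8 by lra.
have G1 := spreadingP a e4; rewrite -{1}cm1 in G1.
have G2 := spreadingP a e4; rewrite -{1}cm2 in G2.
have G3 := spreadingP b e4; rewrite sb in G3.
have G4 := spreadingP c e4; rewrite sc in G4.
have {}G1 := generic_mask (FU := FU) G1.
have {}G2 := generic_mask (FU := FU) G2; rewrite sm2 in G2.
have [s ss [H1 [H2 [H3 H4]]]] :=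
  generic_ex (genericI G1 (genericI G2 (genericI G3 G4))).
have [Hb Hc] := Hs s ss.
have := nsp (lincomb x a (mask m2 s)) (lincomb x a (mask m1 s)).
rewrite Hb Hc !snZ_ge0 //.
move: H1 H2 H3 H4; rewrite !ltr_norml; set u1 := p _; set u2 := p (lincomb x a _).
set v1 := p _; set v2 := p (lincomb x c _) => H1 H2 H3 H4.
have : spreading a - e / 8 <= Num.min u2 u1 by rewrite le_min; apply/andP; split; lra.
have : 2 * (Num.min (spreading b) (spreading c) - e / 8) <= Num.min (2 * v1) (2 * v2).
  rewrite le_min; have := ge_min (spreading b) (spreading b) (spreading c).
  have := ge_min (spreading c) (spreading b) (spreading c).
  by rewrite !lexx orbT /= => *; apply/andP; split; lra.
set m := Num.min u2 u1; set m' := Num.min (2 * v1) _.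
set w := Num.min (spreading b) _ => Hw Hm.
have : k * (spreading a - e / 8) <= k * m by rewrite ler_pM2l.
have : k * (e / 8) <= e / 8 by rewrite ler_piMl // ltW.
lra.
Qed.

Let averageE i0 M s : (M <= size s)%N ->
  average x (take M s) = M%:R^-1 *: \sum_(i < M) x (nth i0 s i).
Proof.
move=> Ms; rewrite /average size_takel // (big_nth i0) size_takel // big_mkord.
by congr (_ *: _); apply: eq_bigr => i _; rewrite nth_take.
Qed.

Let lincomb_take a s : lincomb x a (take (size a) s) = lincomb x a s.
Proof. by elim: a s => [|t a IH] [|i s] //=; rewrite IH. Qed.

(** The mean of [M] translates of [a1] on one block and of [a2] on a later block is the difference
    of two averages up to a boundary error of order 1/M, and its norm is at most about
    [spreading (a1 ++ a2)]. *)
Let wave_lower (e : R) a1 a2 : (forall M, (0 < M)%N ->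
    ~ generic U (M + M) (fun s => p (average x (take M s) - average x (drop M s)) <= e)) ->
  \sum_(t <- a1) t = 1 -> \sum_(t <- a2) t = -1 -> e <= spreading (a1 ++ a2).
Proof.
move=> nC s1 s2; rewrite leNgt; apply/negP => Lt.
pose g := (e - spreading (a1 ++ a2)) / 2.
have g0 : 0 < g by rewrite /g; lra.
pose T1 := 2 * B * (size a1)%:R * \sum_(t <- a1) `|t|.
pose T2 := 2 * B * (size a2)%:R * \sum_(t <- a2) `|t|.
have T0 : 0 <= T1 + T2 by rewrite addr_ge0 // !mulr_ge0 // ?sumr_ge0.
pose M := (Num.truncn ((T1 + T2) / g)).+1.
have Mg : T1 + T2 < M%:R * g by rewrite -ltr_pdivrMr // /M truncnS_gt.
have M0 : 0 < M%:R :> R by rewrite ltr0n.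
(* Blocks with room for all [M] translates. *)
pose N1 := (M + size a1)%N; pose N2 := (M + size a2)%N.
have W1 : generic U N1 (fun s1 => generic U N2 (fun s2 => forall i : 'I_M,
    `|p (lincomb x a1 (drop i s1) + lincomb x a2 (drop i s2)) - spreading (a1 ++ a2)| < g)).
  suff H (i : 'I_M) : generic U (N1 + N2) (fun s =>
    `|p (lincomb x a1 (drop i (take N1 s)) + lincomb x a2 (drop i (drop N1 s)))
      - spreading (a1 ++ a2)| < g).
    apply: genericS ((generic_cat _ _ _).1 (generic_forall H)) => t1 st1.
    by apply: genericS => t2 _ Ht i; have := Ht i; rewrite take_size_cat // drop_size_cat.
  have := spreadingP (a1 ++ a2) g0; rewrite size_cat generic_cat => HL.
  rewrite generic_cat.
  have iM := ltn_ord i.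
  have le1 : (i + size a1 <= N1)%N by rewrite leq_add2r ltnW.
  have le2 : (i + size a2 <= N2)%N by rewrite leq_add2r ltnW.
  apply: genericS (generic_window le1 HL) => t1 st1 Ht.
  apply: genericS (generic_window le2 Ht) => t2 st2.
  rewrite take_size_cat // drop_size_cat // lincomb_cat ?lincomb_take //.
  by rewrite size_takel // size_drop st1; lia.
have W2 : generic U N1 (fun s1 => generic U N2 (fun s2 =>
    ~ p (average x (take M s1) - average x (take M s2)) <= e)).
  have := genericN (FU := FU) (nC M isT); rewrite generic_cat => HC.
  have le1 : (0 + M <= N1)%N by rewrite leq_addr.
  have le2 : (0 + M <= N2)%N by rewrite leq_addr.
  apply: genericS (generic_window le1 HC) => t1 st1 Ht.
  apply: genericS (generic_window le2 Ht) => t2 st2.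
  by rewrite !drop0 take_size_cat ?drop_size_cat // size_takel // st1 leq_addr.
have [t1 st1 [Gt1 [Ht1 bt1]]] :=
  generic_ex (genericI W1 (genericI W2 (generic_bounded N1))).
have [t2 st2 [Gt2 [Ht2 bt2]]] :=
  generic_ex (genericI Gt1 (genericI Ht1 (generic_bounded N2))).
have [i0 _] : exists i0 : I, True by have [i0 _] := filter_ex xB; exists i0.
apply: Ht2; rewrite !(averageE i0) ?st1 ?st2 ?leq_addr // -scalerBr snZ_ge0 ?invr_ge0 //.
rewrite ler_pdivrMl //.
have Ms1 : (M + size a1 <= size t1)%N by rewrite st1.
have Ms2 : (M + size a2 <= size t2)%N by rewrite st2.
have := sum_translates i0 B0 bt2 Ms2; rewrite s2 scaleN1r -/T2.
have := sum_translates i0 B0 bt1 Ms1; rewrite s1 scale1r -/T1.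
set S1 := \sum_(i < M) x (nth i0 t1 i); set S2 := \sum_(i < M) x (nth i0 t2 i).
set Q1 := \sum_(i < M) _; set Q2 := \sum_(i < M) lincomb _ _ _ => H1 H2.
have HQ : p (Q1 + Q2) <= M%:R * (spreading (a1 ++ a2) + g).
  rewrite -big_split /= (le_trans (sn_sum _ _ _ _)) //.
  rewrite -[M in M%:R]card_ord -sum1_card natr_sum mulr_suml ler_sum // => i _.
  by have := Gt2 i; rewrite mul1r ltr_norml; lra.
have -> : S1 - S2 = (Q1 + Q2) - ((Q1 - S1) + (Q2 - - S2)).
  rewrite opprK (opprD (Q1 - S1)) addrACA opprB (addrC Q1) subrK.
  by rewrite opprD (addrA Q2) subrr add0r.
apply: le_trans (snB _ _ _) _.
have := snD p (Q1 - S1) (Q2 - - S2).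
have ge : e = spreading (a1 ++ a2) + 2 * g by rewrite /g; lra.
rewrite ge; nra.
Qed.

(** Otherwise every wave has norm at least [e]. The least norm [q n] of a wave through [n.+1] values
    would then grow geometrically by nonsquareness, although it is at most linear in [n]. *)
Lemma averages_close (e : R) : 0 < e -> exists2 M, (0 < M)%N &
  generic U (M + M) (fun s => p (average x (take M s) - average x (drop M s)) <= e).
Proof.
move=> e0; apply: contrapT => /forall2NP nC.
have {}nC M : (0 < M)%N ->
    ~ generic U (M + M) (fun s => p (average x (take M s) - average x (drop M s)) <= e).
  by move=> M0; case: (nC M).
have tail n v a : wave n v 1 a -> \sum_(t <- a) t = -1.
  have : forall n v sg a, wave n v sg a -> sg + \sum_(t <- a) t = 0.
    move=> {}n; elim: n => [//|n IH] {}v sg {}a [a1 [a2 [-> s1 /IH]]].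
    by rewrite big_cat /= addrA s1.
  by move=> H /H; lra.
have Wlb n a : wave n.+1 1 0 a -> e <= spreading a.
  move=> [a1 [a2 [-> s1 wa]]]; apply: wave_lower => //; first by rewrite -s1 add0r.
  exact: tail wa.
pose W n := [set spreading a | a in wave n.+1 1 0].
have Winf n : has_inf (W n).
  split; last by exists e => _ [a /Wlb ea <-].
  by have [||a wa _] := @wave_exists R n.+1 1 0; rewrite ?normr1 ?normr0 //; exists (spreading a), a.
pose q n := inf (W n).
have qe n : e <= q n.
  by apply: lb_le_inf; [exact: (Winf n).1|move=> _ [a /Wlb ea <-]].
have qle n a : wave n.+1 1 0 a -> q n <= spreading a.
  by move=> wa; apply: ge_inf; [exact: (Winf n).2|exists a].
have qub n : q n <= B * (n.+2%:R * 2).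
  have [||a wa an] := @wave_exists R n.+1 1 0; rewrite ?normr1 ?normr0 //.
  by rewrite (le_trans (qle _ _ wa)) // (le_trans (spreading_le a)) // ler_wpM2l.
(* Doubling a nearly optimal wave yields waves through [n.+2] and [n.+1] values, one of them shorter
   by the factor [1 - k / 2]. By minimality it is not the first, and
   [(1 + k / 2) * (1 - k / 2) <= 1]. *)
have growth n : (1 + k / 2) * q n <= q n.+1.
  have H : Num.min (q n.+1) (q n) <= (1 - k / 2) * q n.+1.
    apply/ler_addgt0Pr => d d0.
    have [_ [a wa <-] ad] := inf_adherent d0 (Winf n.+1).
    have [m1 [m2 [b [c [D wb _ wc]]]]] := doubling_wave x wa.
    have := spreading_nonsquare D.
    have : Num.min (q n.+1) (q n) <= Num.min (spreading b) (spreading c).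
      by rewrite le_min !ge_min (qle _ _ wb) (qle _ _ wc) orbT.
    rewrite -/(q n.+1) in ad.
    have := qle _ _ wa; move: k0 k1; nra.
  have qp := lt_le_trans e0 (qe n.+1).
  have k2 : 0 < k / 2 by rewrite divr_gt0.
  move: H; rewrite ge_min => /orP[|] H.
    have : 0 < k / 2 * q n.+1 by rewrite mulr_gt0.
    by lra.
  have : (1 + k / 2) * q n <= (1 + k / 2) * ((1 - k / 2) * q n.+1).
    by rewrite ler_wpM2l //; lra.
  have : 0 <= (k / 2) ^+ 2 * q n.+1 by rewrite mulr_ge0 ?exprn_ge0 // ltW.
  lra.
(* The first three binomial terms of [(1 + k / 2) ^+ n] suffice: a quadratic bound beats the linear
   one. *)
have qlb n : e * (1 + n%:R * (k / 2) + (k / 2) ^+ 2 * n%:R * (n%:R - 1) / 2) <= q n.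
  elim: n => [|n IH]; first by have := qe 0; rewrite !(mulr0, mul0r) !addr0 mulr1.
  have c0 : 0 <= 1 + k / 2 by move: k0; lra.
  apply: le_trans (le_trans _ (ler_wpM2l c0 IH)) (growth n).
  rewrite -natr1; set m := n%:R; have m0 : 0 <= m by exact: ler0n.
  have : 0 <= n%:R * (n%:R - 1) :> R.
    by case: (n) => [|l]; rewrite ?mul0r // mulr_ge0 // subr_ge0 ler1n.
  rewrite -/m => mm; rewrite [leRHS]mulrCA ler_pM2l //.
  have : 0 <= (k / 2) ^+ 3 * (m * (m - 1)) / 2.
    by rewrite divr_ge0 // mulr_ge0 // exprn_ge0 // divr_ge0 // ltW.
  lra.
pose t := e * (k / 2) ^+ 2 / 2.
have t0 : 0 < t by rewrite divr_gt0 // mulr_gt0 // exprn_gt0 // divr_gt0.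
(* So that [6 * B < (n - 1) * t]; and [2 * B * (n + 2) <= 6 * B * n] since [1 <= n]. *)
pose n := (Num.truncn ((6 * B) / t)).+2.
have : 6 * B / t < n%:R - 1 by rewrite /n -(natr1 (Num.truncn _).+1) addrK truncnS_gt.
rewrite ltr_pdivrMr // => nt.
have n1 : 1 <= n%:R :> R by rewrite ler1n.
clearbody n; have := le_trans (qlb n) (qub n); rewrite -(natr1 n.+1) -(natr1 n).
have : n%:R * (6 * B) < n%:R * ((n%:R - 1) * t) by rewrite ltr_pM2l // (lt_le_trans _ n1).
have -> : e * (1 + n%:R * (k / 2) + (k / 2) ^+ 2 * n%:R * (n%:R - 1) / 2) =
  e + e * (n%:R * (k / 2)) + n%:R * ((n%:R - 1) * t) by rewrite /t; lra.
have : 0 <= e * (n%:R * (k / 2)) by rewrite mulr_ge0 ?mulr_ge0 ?divr_ge0 ?ltW //; lra.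
move: B0 n1; nra.
Qed.

End BanachSaks.

(** * Limits of averages *)
(* A seminorm assembled from finitely many nonsquare ones.  Only two traces of
   the underlying absolute norm on R^r are kept: it dominates each coordinate,
   and at every vector it is normed by a nonnegative functional. *)
Record split_norm (R : realType) (E : lmodType R) := SplitNorm {
  total :> seminorm E;
  rank : nat;
  part : 'I_rank -> seminorm E;
  nsq : R;
  nsq_gt0 : 0 < nsq;
  nsq_le1 : nsq <= 1;
  part_nonsquare : forall j, nonsquare nsq (part j);
  part_le : forall j x, part j x <= total x;
  dual : forall x0, exists f : 'I_rank -> R,
    [/\ forall j, 0 <= f j <= 1, \sum_j f j * part j x0 = total x0 &
        forall x, \sum_j f j * part j x <= total x] }.

Section Sets.
Variables (R : realType) (E : lmodType R) (N : seminorm E).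
Implicit Types (C K : set E) (x y z : E).

Definition convex_set C := forall x y (t : R), C x -> C y -> 0 <= t -> t <= 1 ->
  C (t *: x + (1 - t) *: y).

Definition bounded_by (B : R) C := forall x, C x -> N x <= B.

Definition complete_set C := forall u : nat -> E, (forall n, C (u n)) ->
  (forall e, 0 < e -> exists n0, forall m n, (n0 <= m)%N -> (n0 <= n)%N ->
     N (u m - u n) <= e) ->
  exists2 z, C z &
    forall e, 0 < e -> exists n0, forall n, (n0 <= n)%N -> N (u n - z) <= e.

Definition body C := [/\ exists B, bounded_by B C, convex_set C & complete_set C].

(** Closed relative to [C] for the seminorm: a point of [C] at distance 0 from [K] belongs to
    [K]. *)
Definition closed_in C K := K `<=` C /\
  forall x, C x -> (forall e, 0 < e -> exists2 y, K y & N (x - y) < e) -> K x.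

Lemma closed_in_body C K : body C -> closed_in C K -> convex_set K -> body K.
Proof.
move=> [[B CB] cC pC] [KC clK] cK; split => //; first by exists B => x /KC /CB.
move=> u Ku cu; have [|z Cz uz] := pC u _ cu; first by move=> n; exact/KC.
exists z => //; apply: clK => // e e0.
have [|n0 /(_ n0 (leqnn _)) Hn] := uz (e / 2); first by rewrite divr_gt0.
by exists (u n0) => //; rewrite sn_distC; lra.
Qed.

Lemma convex_average (I : Type) (x : I -> E) C s : convex_set C -> (0 < size s)%N ->
  all (fun i => `[< C (x i) >]) s -> C (average x s).
Proof.
move=> cC; case: s => [//|i s] _; elim: s i => [|j s IH] i.
  by rewrite /average /= andbT invr1 scale1r big_seq1 => /asboolP.
rewrite [all _ _]/= => /andP[/asboolP Ci /(IH j) Cs].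
have n0 : 0 < (size (i :: j :: s))%:R :> R by rewrite ltr0n.
have n1 : (size (i :: j :: s))%:R^-1 <= 1 :> R by rewrite invf_le1 // ler1n.
have := cC _ _ _ Ci Cs (ltW (_ : 0 < (size (i :: j :: s))%:R^-1)) n1.
rewrite invr_gt0 => /(_ n0).
rewrite /average scalerA [\sum_(k <- [:: i, j & s]) _]big_cons scalerDr.
congr (C (_ + _ *: _)); rewrite /= -(natr1 (size s).+1).
have m0 : (size s).+1%:R != 0 :> R by rewrite pnatr_eq0.
have m1 : (size s).+1%:R + 1 != 0 :> R by rewrite natr1 pnatr_eq0.
move: m0 m1; move: (_.+1%:R) => m m0 m1; by field; rewrite ?m0 ?m1.
Qed.

Lemma average_le (I : Type) (x : I -> E) (d : R) s : (0 < size s)%N ->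
  all (fun i => N (x i) <= d) s -> N (average x s) <= d.
Proof.
move=> s0 sd; have n0 : 0 < (size s)%:R :> R by rewrite ltr0n.
rewrite /average snZ_ge0 ?invr_ge0 ?ler0n // ler_pdivrMl // (le_trans (sn_sum _ _ _ _)) //.
elim: s sd {s0 n0} => [|i s IH] /=; first by rewrite big_nil mul0r.
by move=> /andP[id /IH H]; rewrite big_cons -natr1 mulrDl mul1r addrC lerD.
Qed.

Lemma average_sub (I : Type) (x y : I -> E) s :
  average (fun i => x i - y i) s = average x s - average y s.
Proof. by rewrite /average sumrB scalerBr. Qed.

Lemma average_cst (I : Type) y (s : seq I) : (0 < size s)%N ->
  average (fun=> y) s = y.
Proof.
move=> s0; rewrite /average big_const_seq count_predT iter_addr_0 -[y *+ _]scaler_nat.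
by rewrite scalerA mulVf ?scale1r // pnatr_eq0 -lt0n.
Qed.

Lemma average_chunks (I : Type) (x : I -> E) (v : E) (e : R) q M (s : seq I) :
  (0 < q)%N -> (0 < M)%N -> size s = (q * M)%N ->
  (forall i : 'I_q, N (average x (take M (drop (i * M) s)) - v) <= e) ->
  N (average x s - v) <= e.
Proof.
move=> q0 M0 ss H.
have sumE : \sum_(i <- s) x i = \sum_(i < q) \sum_(j <- take M (drop (i * M) s)) x j.
  elim: q s ss {q0 H} => [|q IH] s; first by rewrite mul0n big_ord0 => /size0nil ->; rewrite big_nil.
  rewrite mulSn => ss; rewrite big_ord_recl /= mul0n drop0.
  rewrite -{1}(cat_take_drop M s) big_cat /= (IH (drop M s)); last first.
    by rewrite size_drop ss addKn.
  by congr (_ + _); apply: eq_bigr => i _; rewrite drop_drop -mulSnr.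
have chunk (i : 'I_q) : size (take M (drop (i * M) s)) = M.
  rewrite size_takel // size_drop ss -mulnBl -{1}(mul1n M) leq_mul2r.
  by rewrite subn_gt0 ltn_ord orbT.
have M0' : M%:R != 0 :> R by rewrite pnatr_eq0 -lt0n.
have q0' : q%:R != 0 :> R by rewrite pnatr_eq0 -lt0n.
have -> : average x s - v =
    q%:R^-1 *: \sum_(i < q) (average x (take M (drop (i * M) s)) - v).
  rewrite sumrB sumr_const card_ord -[v *+ _]scaler_nat scalerBr (scalerA _ _ v) mulVf // scale1r.
  congr (_ - _); rewrite /average sumE ss natrM invfM -scalerA; congr (_ *: _).
  by rewrite scaler_sumr; apply: eq_bigr => i _; rewrite chunk.
rewrite snZ_ge0 ?invr_ge0 // ler_pdivrMl ?ltr0n // (le_trans (sn_sum _ _ _ _)) //.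
rewrite -[q in q%:R]card_ord -sum1_card natr_sum mulr_suml ler_sum // => i _.
by rewrite mul1r.
Qed.

End Sets.

Section AverageLimit.
Variables (R : realType) (E : lmodType R) (I : Type) (U : set_system I).
Context {FU : UltraFilter U}.
Variables (N : seminorm E).
Implicit Types (C K : set E) (x y : I -> E) (z w : E).

(* Replaces the weak limit of x along U. *)
Definition average_lim x z := forall e : R, 0 < e -> exists2 M, (0 < M)%N &
  forall q, (0 < q)%N -> generic U (q * M) (fun s => N (average x s - z) <= e).

Lemma generic_chunks x (v : E) (e : R) q M : (0 < q)%N -> (0 < M)%N ->
  generic U M (fun s => N (average x s - v) <= e) ->
  generic U (q * M) (fun s => N (average x s - v) <= e).
Proof.
move=> q0 M0 H.
have : forall i : 'I_q, generic U (q * M)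
    (fun s => N (average x (take M (drop (i * M) s)) - v) <= e).
  move=> i; apply: (@generic_window _ U FU M (q * M) (i * M) (fun s => N (average x s - v) <= e)) => //.
  by rewrite -mulSnr leq_mul2r ltn_ord orbT.
move=> /generic_forall; apply: genericS => s ss Hs.
exact: average_chunks Hs.
Qed.

Lemma average_lim_closed C K x z : convex_set K -> closed_in N C K ->
  U [set i | K (x i)] -> C z -> average_lim x z -> K z.
Proof.
move=> cK [KC clK] UK Cz xz; apply: clK => // e e0.
have [|M M0 /(_ 1 isT)] := xz (e / 2); first by rewrite divr_gt0.
rewrite mul1n => HM.
have UK' : U [set i | `[< K (x i) >]] by apply: filterS UK => i /asboolP.
have [s sM [sK sz]] := generic_ex (genericI (generic_all M UK') HM).
exists (average x s); first by apply: convex_average => //; rewrite sM.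
by rewrite sn_distC; lra.
Qed.

(** This is why [average_lim] asks for all multiples of a length: both averages can be tested on one
    generic sequence of length [L * M]. *)
Lemma average_lim_dist x y z w (d : R) : average_lim x z -> average_lim y w ->
  U [set i | N (x i - y i) <= d] -> N (z - w) <= d.
Proof.
move=> xz yw xyd; apply/ler_addgt0Pr => e e0.
have e2 : 0 < e / 2 by rewrite divr_gt0.
have [M M0 HM] := xz _ e2; have [L L0 HL] := yw _ e2.
have G1 := HM L L0; have G2 := HL M M0; rewrite mulnC in G2.
have [s sn [zs [ws xys]]] :=
  generic_ex (genericI G1 (genericI G2 (generic_all (L * M) xyd))).
have s0 : (0 < size s)%N by rewrite sn muln_gt0 L0.
have := average_le s0 xys; rewrite average_sub.
have := sn_distD N (average x s) z w; have := sn_distD N (average y s) (average x s) w.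
rewrite (sn_distC N z (average x s)); lra.
Qed.

End AverageLimit.

Section AverageLimitExists.
Variables (R : realType) (E : lmodType R) (N : split_norm E).
Variables (I : Type) (U : set_system I).
Context {FU : UltraFilter U}.

(** Long generic averages are close in every coordinate, hence in [N] by a norming functional. One
    fixed average [y n] per precision gives a Cauchy sequence, as [y m] and [y n] are both close to
    a generic average of length [M m * M n]. *)
Lemma average_lim_exists C (x : I -> E) : body N C -> U [set i | C (x i)] ->
  exists2 z, C z & average_lim U N x z.
Proof.
move=> [[B CB] cC pC] UC.
have bnd (j : 'I_(rank N)) : U [set i | part j (x i) <= Num.max B 0].
  apply: filterS UC => i /CB /= iB.
  by rewrite (le_trans (part_le _ _)) // le_max iB.
have B0 : 0 <= Num.max B 0 by rewrite le_max lexx orbT.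
(* Closeness at length [M] passes to length [q * M], by cutting both halves into chunks. *)
have refine (p : seminorm E) (e : R) q M : (0 < q)%N -> (0 < M)%N ->
    generic U (M + M) (fun s => p (average x (take M s) - average x (drop M s)) <= e) ->
    generic U (q * M + q * M)
     (fun s => p (average x (take (q * M) s) - average x (drop (q * M) s)) <= e).
  move=> q0 M0; rewrite !generic_cat => H.
  have H1 : generic U M (fun s => generic U (q * M) (fun s' =>
      p (average x s - average x s') <= e)).
    apply: genericS H => s sM H.
    apply: genericS (generic_chunks (N := p) (x := x) (v := average x s) (e := e) q0 M0 _).
      by move=> s' _; rewrite sn_distC.
    by apply: genericS H => s' _; rewrite take_size_cat // drop_size_cat // sn_distC.
  have : forall i : 'I_q, generic U (q * M) (fun s => generic U (q * M) (fun s' =>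
      p (average x (take M (drop (i * M) s)) - average x s') <= e)).
    move=> i; apply: generic_window H1.
    by rewrite -mulSnr leq_mul2r ltn_ord orbT.
  move=> /generic_forall; apply: genericS => s ss /generic_forall; apply: genericS => s' ss' Hs.
  rewrite take_size_cat // drop_size_cat //.
  exact: average_chunks Hs.
have part_close (e : R) : 0 < e -> exists2 M, (0 < M)%N & forall j : 'I_(rank N),
    generic U (M + M) (fun s => part j (average x (take M s) - average x (drop M s)) <= e).
  move=> e0.
  have /choice[M HM] (j : 'I_(rank N)) : exists M, (0 < M)%N /\
      generic U (M + M) (fun s => part j (average x (take M s) - average x (drop M s)) <= e).
    have [M M0 HM] := averages_close (nsq_gt0 N) (nsq_le1 N) (part_nonsquare j) B0 (bnd j) e0.
    by exists M.
  (* A common multiple of the lengths serves all coordinates at once. *)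
  exists (\prod_j M j)%N; first by rewrite prodn_gt0 // => j; case: (HM j).
  move=> j; rewrite (bigD1 j) //= mulnC; apply: refine; last by case: (HM j).
    by rewrite prodn_cond_gt0 // => i _; case: (HM i).
  by case: (HM j).
have total_close (e : R) : 0 < e -> exists2 M, (0 < M)%N &
    generic U M (fun s => generic U M (fun s' => N (average x s - average x s') <= e)).
  move=> e0; have r0 : 0 < (rank N).+1%:R :> R by rewrite ltr0n.
  (* The successor avoids division by zero when the rank is 0. *)
  have [|M M0 HM] := part_close (e / (rank N).+1%:R); first by rewrite divr_gt0.
  exists M => //; move: HM => /generic_forall; rewrite generic_cat.
  apply: genericS => s sM; apply: genericS => s' _.
  rewrite take_size_cat // drop_size_cat // => H.
  have [f [f01 <- _]] := dual N (average x s - average x s').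
  have : \sum_(j < rank N) f j * part j (average x s - average x s') <=
         \sum_(j < rank N) e / (rank N).+1%:R.
    apply: ler_sum => j _; apply: le_trans (H j).
    by rewrite ler_piMl ?sn_ge0 //; case/andP: (f01 j).
  move=> /le_trans; apply; rewrite sumr_const card_ord -[_ *+ _]mulr_natr.
  rewrite -mulrA ler_piMr ?(ltW e0) // ler_pdivrMl // mulr1 ler_nat leqnSn //.
have UC' : U [set i | `[< C (x i) >]] by apply: filterS UC => i /asboolP.
have /choice[M HM] (n : nat) : exists L, (0 < L)%N /\
    generic U L (fun s => generic U L (fun s' => N (average x s - average x s') <= n.+1%:R^-1)).
  have [|M0 ? ?] := total_close n.+1%:R^-1; first by rewrite invr_gt0 ltr0n.
  by exists M0.
have /choice[s Hs] (n : nat) : exists s0, [/\ size s0 = M n, all (fun i => `[< C (x i) >]) s0 &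
    generic U (M n) (fun s' => N (average x s' - average x s0) <= n.+1%:R^-1)].
  have [M0 HMn] := HM n.
  have [s sM [sC Hs]] := generic_ex (genericI (generic_all (M n) UC') HMn).
  by exists s; split => //; apply: genericS Hs => s' _; rewrite sn_distC.
have M0 n : (0 < M n)%N by case: (HM n).
pose y n := average x (s n).
have Cy n : C (y n) by have [sM sC _] := Hs n; apply: convex_average; rewrite ?sM.
have yG n q : (0 < q)%N -> generic U (q * M n) (fun s' => N (average x s' - y n) <= n.+1%:R^-1).
  by move=> q0; apply: generic_chunks => //; case: (Hs n).
have small (e : R) : 0 < e -> exists n0, forall n, (n0 <= n)%N -> n.+1%:R^-1 <= e.
  move=> e0; exists (Num.truncn e^-1) => n ln.
  rewrite -[e]invrK lef_pV2 ?posrE ?invr_gt0 ?ltr0n // ltW //.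
  by rewrite (lt_le_trans (truncnS_gt _)) // ler_nat.
have [e e0|z Cz yz] := pC y Cy.
  have [|n0 Hn0] := small (e / 2); first by rewrite divr_gt0.
  exists n0 => m n lm ln.
  have G1 := yG m (M n) (M0 n); have G2 := yG n (M m) (M0 m); rewrite mulnC in G2.
  have [t _ [t1 t2]] := generic_ex (genericI G1 G2).
  have := sn_distD N (average x t) (y m) (y n); rewrite (sn_distC N (y m) (average x t)).
  by have := le_trans t1 (Hn0 _ lm); have := le_trans t2 (Hn0 _ ln); lra.
exists z => // e e0; have e2 : 0 < e / 2 by rewrite divr_gt0.
have [n0 Hn0] := small _ e2; have [n1 Hn1] := yz _ e2.
pose n := maxn n0 n1; exists (M n) => // q q0.
apply: genericS (yG n q q0) => t _ Ht.
have := sn_distD N (y n) (average x t) z.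
have := le_trans Ht (Hn0 n (leq_maxl _ _)); have := Hn1 n (leq_maxr _ _); lra.
Qed.

End AverageLimitExists.

(** * Asymptotic regularity *)
Section Nonexpansive.
Variables (R : realType) (E : lmodType R) (N : seminorm E).
Implicit Types (C K : set E) (S : E -> E).

Definition maps_into C S := forall x, C x -> C (S x).

Definition nonexpansive C S := forall x y, C x -> C y -> N (S x - S y) <= N (x - y).

(** The Krasnoselskii averaging of [S]; the second weight is spelled as in [convex_set]. *)
Definition halfway S x := 2^-1 *: x + (1 - 2^-1) *: S x.

Variables (C : set E) (S : E -> E) (B : R).
Hypotheses (CB : bounded_by N B C) (cC : convex_set C).
Hypotheses (SC : maps_into C S) (Sne : nonexpansive C S).

Lemma halfway_into : maps_into C (halfway S).
Proof. by move=> x Cx; apply: cC => //; [exact: SC|lra|lra]. Qed.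

Lemma iter_halfway_into n : maps_into C (iter n (halfway S)).
Proof. by elim: n => [//|n IH] x Cx; exact/halfway_into/IH. Qed.

Lemma halfway_nonexpansive : nonexpansive C (halfway S).
Proof.
move=> x y Cx Cy; rewrite /halfway opprD addrACA -!scalerBr.
rewrite (le_trans (snD _ _ _)) // !snZ !ger0_norm; [|lra|lra].
have := Sne Cx Cy; lra.
Qed.

Lemma iter_halfway_nonexpansive n : nonexpansive C (iter n (halfway S)).
Proof.
elim: n => [//|n IH] x y Cx Cy /=; apply: le_trans (IH _ _ Cx Cy).
by apply: halfway_nonexpansive; exact: iter_halfway_into.
Qed.

Lemma halfway_dist x : N (halfway S x - x) = N (S x - x) / 2.
Proof.
have -> : halfway S x - x = 2^-1 *: (S x - x).
  rewrite /halfway addrAC -{2}(scale1r x) -scalerBl (_ : 2^-1 - 1 = - 2^-1); last by lra.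
  by rewrite (_ : 1 - 2^-1 = 2^-1); [rewrite scaleNr scalerBr addrC|lra].
by rewrite snZ_ge0 ?invr_ge0 // mulrC.
Qed.

Lemma iter_halfway_dist n x : C x -> N (iter n (halfway S) x - x) <= n%:R * N (S x - x).
Proof.
move=> Cx; elim: n => [|n IH] /=; first by rewrite subrr sn0 mul0r.
apply: le_trans (sn_distD N (halfway S x) _ _) _.
have := halfway_nonexpansive (iter_halfway_into n Cx) Cx.
rewrite halfway_dist -(natr1 n) mulrDl mul1r.
have := sn_ge0 N (S x - x); lra.
Qed.

Lemma halfway_displacement x : C x -> N (S (halfway S x) - halfway S x) <= N (S x - x).
Proof.
move=> Cx; have -> : S (halfway S x) - halfway S x =
    (S (halfway S x) - S x) + 2^-1 *: (S x - x).
  rewrite -addrA; congr (_ + _); rewrite /halfway scalerBl scale1r scalerBr.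
  by rewrite opprD opprB [LHS]addrC (addrC (2^-1 *: S x) (- S x)) -addrA.
rewrite (le_trans (snD _ _ _)) // (snZ_ge0 N) ?invr_ge0 //.
have := Sne (halfway_into Cx) Cx; rewrite halfway_dist; lra.
Qed.

(* The Goebel-Kirk inequality, which makes the asymptotic regularity of the
   averaged iterates uniform on C. *)
Lemma goebel_kirk (u : nat -> E) (r := fun i => N (S (u i) - u i)) n i :
  (forall j, C (u j)) -> (forall j, u j.+1 = halfway S (u j)) ->
  (1 + n%:R / 2) * r i <= N (S (u (i + n)%N) - u i) + 2 ^+ n * (r i - r (i + n)%N).
Proof.
move=> Cu uS.
have step j : N (u j.+1 - u j) = r j / 2 by rewrite uS halfway_dist.
have rS j : r j.+1 <= r j by rewrite /r uS halfway_displacement.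
have rle j m : r (j + m)%N <= r j.
  by elim: m => [|m IH]; rewrite ?addn0 // addnS (le_trans (rS _)).
elim: n i => [|n IH] i.
  by rewrite addn0 mul0r addr0 mul1r subrr mulr0 addr0.
have H := IH i.+1; rewrite addSn -addnS in H.
have path m : N (u (i + m)%N - u i) <= m%:R / 2 * r i.
  elim: m => [|m IHm]; first by rewrite addn0 subrr sn0 !mul0r.
  rewrite addnS (le_trans (sn_distD N (u (i + m)%N) _ _)) // step -(natr1 m).
  have := rle i m; lra.
have H2 : N (S (u (i + n.+1)%N) - u i.+1) <=
    2^-1 * N (S (u (i + n.+1)%N) - u i) + 2^-1 * (n.+1%:R / 2 * r i).
  have -> : S (u (i + n.+1)%N) - u i.+1 = 2^-1 *: (S (u (i + n.+1)%N) - u i)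
      + 2^-1 *: (S (u (i + n.+1)%N) - S (u i)).
    rewrite uS /halfway; set v := u i; set w := S v; set T := S _.
    rewrite !scalerBr addrACA -scalerDl (_ : 2^-1 + 2^-1 = 1); last by lra.
    by rewrite scale1r opprD (_ : 1 - 2^-1 = 2^-1) //; lra.
  rewrite (le_trans (snD _ _ _)) // !(snZ_ge0 N) ?invr_ge0 // lerD2l.
  by rewrite ler_pM2l ?invr_gt0 // (le_trans (Sne (Cu _) (Cu _))).
(* Twice the induction hypothesis leaves [(n + 2) * (r i - r i.+1)] to be absorbed by
   [2 ^+ n.+1 * (r i - r i.+1)]. *)
have := rS i; have p2 : n%:R + 2 <= 2 ^+ n.+1 :> R.
  elim: (n) => [|m IHm]; first by rewrite expr1 add0r.
  rewrite exprS -(natr1 m); have := ler0n R m; lra.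
move: H H2 p2; rewrite exprS -(natr1 n); set Q := 2 ^+ n; set a := r i; set b := r i.+1.
set d := r _; set m := n%:R; set z := N (S _ - u i); set z' := N (S _ - u i.+1).
nra.
Qed.

Lemma asymptotic_regularity (e : R) : 0 < e -> exists n, forall y, C y ->
  N (S (iter n (halfway S) y) - iter n (halfway S) y) <= e.
Proof.
move=> e0; have B0 (y : E) : C y -> 0 <= B by move=> /CB; apply: le_trans; exact: sn_ge0.
(* With this [n] the Goebel-Kirk inequality gives displacement at most [e] once its last term is at
   most 1. *)
pose n := (Num.truncn ((2 * B + 1) * 2 / e)).+1.
have en : (2 * B + 1) * 2 < n%:R * e by rewrite -ltr_pdivrMr // truncnS_gt.
pose L := (Num.truncn (2 * B * 2 ^+ n)).+1.
have HL : 2 * B * 2 ^+ n < L%:R by exact: truncnS_gt.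
exists (L * n)%N => y Cy; pose u i := iter i (halfway S) y; pose r i := N (S (u i) - u i).
have Cu j : C (u j) by exact: iter_halfway_into.
have rS j : r j.+1 <= r j by exact: halfway_displacement.
have rmono j m : (j <= m)%N -> r m <= r j.
  by move=> /subnKC <-; elim: (m - j)%N => [|l IH]; rewrite ?addn0 // addnS (le_trans (rS _)).
have dist2B v w : C v -> C w -> N (v - w) <= 2 * B.
  by move=> /CB Nv /CB Nw; rewrite (le_trans (snB _ _ _)) //; lra.
have p2 : 0 < 2 ^+ n :> R by rewrite exprn_gt0.
(* The displacement decreases by at most [2 * B] in all, so among [L] blocks of [n] steps one
   decreases it by at most [2 ^- n]. *)
have [l lL Hl] : exists2 l, (l < L)%N & r (l * n)%N - r (l * n + n)%N <= (2 ^+ n)^-1.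
  apply: contrapT => /forall2NP nH.
  have : r 0%N - r (L * n)%N >= L%:R * (2 ^+ n)^-1.
    suff : forall l, (l <= L)%N -> r 0%N - r (l * n)%N >= l%:R * (2 ^+ n)^-1 by apply.
    elim=> [|l IH] lL; first by rewrite mul0n subrr mul0r.
    have {}IH := IH (ltnW lL); case: (nH l) => // /negP; rewrite -ltNge -mulSnr -(natr1 l).
    lra.
  rewrite ler_pdivrMr //.
  have := dist2B _ _ (SC (Cu 0%N)) (Cu 0%N); have := sn_ge0 N (S (u (L * n)%N) - u (L * n)%N).
  rewrite -/(r 0%N) -/(r _) => H1 H2.
  have : (r 0%N - r (L * n)%N) * 2 ^+ n <= 2 * B * 2 ^+ n by rewrite ler_pM2r //; lra.
  lra.
apply: (@le_trans _ _ (r (l * n)%N)).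
  by apply: (rmono (l * n)%N (L * n)%N); rewrite leq_mul2r ltnW ?orbT.
have := goebel_kirk n (l * n) Cu (fun=> erefl).
have := dist2B _ _ (SC (Cu (l * n + n)%N)) (Cu (l * n)%N).
rewrite -/(r _) -/(r (l * n + n)%N).
have : 2 ^+ n * (r (l * n)%N - r (l * n + n)%N) <= 1 by rewrite mulrC -ler_pdivlMr // mul1r.
set Q := 2 ^+ n * _; set a := r _; set z := N _ => Q1 z2 H.
have a0 : 0 <= a by exact: sn_ge0.
rewrite leNgt; apply/negP => ea.
have : n%:R * e <= n%:R * a by rewrite ler_wpM2l // ltW.
lra.
Qed.

End Nonexpansive.

(** * The geometric contradiction *)
Section PairMean.
Variables (R : realType) (M : nat).
Implicit Types F G : 'I_M -> 'I_M -> R.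

Definition pair_mean F : R := M%:R ^- 2 * \sum_l \sum_l' F l l'.

Lemma pair_mean_le F G : (forall l l', F l l' <= G l l') -> pair_mean F <= pair_mean G.
Proof.
move=> FG; rewrite ler_wpM2l ?invr_ge0 ?exprn_ge0 //.
by apply: ler_sum => l _; apply: ler_sum.
Qed.

Lemma pair_mean_cst (c : R) : (0 < M)%N -> pair_mean (fun _ _ => c) = c.
Proof.
move=> M0; rewrite /pair_mean !sumr_const card_ord -mulrnA -[c *+ _]mulr_natr mulrCA.
by rewrite natrM expr2 mulVf ?mulr1 // mulf_neq0 // pnatr_eq0 -lt0n.
Qed.

Lemma pair_meanD F G : pair_mean (fun l l' => F l l' + G l l') = pair_mean F + pair_mean G.
Proof.
rewrite /pair_mean -mulrDr -big_split; congr (_ * _); apply: eq_bigr => l _.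
by rewrite big_split.
Qed.

Lemma pair_meanZ c F : pair_mean (fun l l' => c * F l l') = c * pair_mean F.
Proof.
rewrite /pair_mean mulrCA [c * _]mulr_sumr; congr (_ * _); apply: eq_bigr => l _.
by rewrite mulr_sumr.
Qed.

Lemma pair_mean_swap F : pair_mean (fun l l' => F l' l) = pair_mean F.
Proof. by rewrite /pair_mean exchange_big. Qed.

Lemma pair_mean_sum (J : finType) (P : pred J) (a : J -> R) (H : J -> 'I_M -> 'I_M -> R) :
  pair_mean (fun l l' => \sum_(j | P j) a j * H j l l')
  = \sum_(j | P j) a j * pair_mean (H j).
Proof.
rewrite /pair_mean; under [RHS]eq_bigr do rewrite mulrCA; rewrite -mulr_sumr.
congr (_ * _); under [RHS]eq_bigr do rewrite mulr_sumr.
rewrite [RHS]exchange_big /=; apply: eq_bigr => l _.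
under [RHS]eq_bigr do rewrite mulr_sumr.
by rewrite exchange_big.
Qed.

End PairMean.

Section Split.
Variables (R : realType) (E : lmodType R) (N : split_norm E).
Local Notation r := (rank N).
Local Notation k := (nsq N).

Lemma nonsquareD (p : seminorm E) (q : R) : nonsquare q p -> forall v u,
  p (v + u) + p (v - u) <= 2 * (p v + p u) - q * Num.min (p v) (p u).
Proof.
move=> np v u; have := np v u; have := snD p v u; have := snB p v u.
rewrite ge_min; set m := q * _ => H1 H2 /orP[]; lra.
Qed.

(* In each coordinate nonsquareness forbids v and the differences w l - w l' to
   be both large while the norms add up, so the coordinates split into those
   carried by the differences (the set D) and those carried by v. *)
Lemma coordinates_split (M : nat) (w : 'I_M -> E) (z : E)
    (f pi : 'I_r -> R) (a b eta d theta : R)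
    (v := M%:R^-1 *: \sum_l w l - z) :
  (0 < M)%N -> 0 < theta -> 0 <= b -> 0 <= eta ->
  (forall j, 0 <= f j <= 1) -> (forall x, \sum_j f j * part j x <= N x) ->
  N v <= a -> (forall l l', N (w l - w l') <= b) ->
  (forall j l, pi j <= part j (w l - z) + eta) ->
  a + b - d <= \sum_j f j * pi j ->
  exists D : {set 'I_r}, \sum_(j in D) f j * pi j <= b + r%:R * (theta + eta) /\
    \sum_(j in ~: D) f j * pi j
      <= a + (1 + b / theta) * (2 / k * (d + r%:R * eta)) + r%:R * eta.
Proof.
move=> M0 th0 b0 eta0 f01 fN va wb pw fpi.
have k0 : 0 < k := nsq_gt0 N.
have f0 j : 0 <= f j by case/andP: (f01 j).
have f1 j : f j <= 1 by case/andP: (f01 j).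
pose B (j : 'I_r) := pair_mean (fun l l' => part j (w l - w l')).
pose G (j : 'I_r) := pair_mean (fun l l' => Num.min (part j v) (part j (w l - w l'))).
have M0' : M%:R != 0 :> R by rewrite pnatr_eq0 -lt0n.
have piB j : pi j <= part j v + B j - k / 2 * G j + eta.
  pose X l l' := part j (v + (w l - w l')).
  have piX : pi j - eta <= pair_mean X.
    have -> : pi j - eta = M%:R ^- 2 * \sum_(l < M) \sum_(l' < M) (pi j - eta).
      by rewrite -[LHS](pair_mean_cst (pi j - eta) M0).
    rewrite ler_wpM2l ?invr_ge0 ?exprn_ge0 //; apply: ler_sum => l _.
    rewrite sumr_const card_ord -[_ *+ _]mulr_natr mulrC -ler_pdivlMl ?ltr0n //.
    have := pw j l; rewrite -lerBlDr => /le_trans; apply.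
    (* Because [v + z] is the mean of the [w l']. *)
    have -> : w l - z = M%:R^-1 *: \sum_l' (v + (w l - w l')).
      rewrite big_split sumr_const card_ord sumrB sumr_const card_ord /=.
      rewrite -[v *+ M]scaler_nat -[w l *+ M]scaler_nat scalerDr (scalerBr _ (_ *: w l)).
      rewrite (scalerA _ _ (w l)) (scalerA _ _ v) mulVf // !scale1r.
      by rewrite /v [RHS]addrC addrA subrK.
    by rewrite snZ_ge0 ?invr_ge0 // ler_wpM2l ?invr_ge0 // sn_sum.
  (* Exchanging [l] and [l'] turns [v + u] into [v - u], the pair to which [nonsquareD] applies. *)
  have XE : pair_mean X = 2^-1 * pair_mean (fun l l' => X l l' + X l' l).
    rewrite pair_meanD (pair_mean_swap X); lra.
  pose Z := pair_mean (fun l l' => X l l' + X l' l).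
  rewrite -/Z in XE; have : Z <=
      pair_mean (fun l l' => 2 * part j v + (2 * part j (w l - w l') +
         (- k) * Num.min (part j v) (part j (w l - w l')))).
    apply: pair_mean_le => l l'; have := nonsquareD (part_nonsquare j) v (w l - w l').
    rewrite /X opprB => /le_trans; apply.
    by rewrite mulNr mulrDr -addrA.
  clearbody Z; rewrite !pair_meanD !pair_meanZ pair_mean_cst // -/(B j) -/(G j) mulNr.
  move: piX; rewrite XE; lra.
have sumv : \sum_j f j * part j v <= a by exact: le_trans (fN v) va.
have sumB : \sum_j f j * B j <= b.
  rewrite -pair_mean_sum -[leRHS](pair_mean_cst b M0); apply: pair_mean_le => l l'.
  exact: le_trans (fN _) (wb _ _).
have B0 j : 0 <= B j.
  by rewrite -[leLHS](pair_mean_cst 0 M0); apply: pair_mean_le => l l'; exact: sn_ge0.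
have G0 j : 0 <= G j.
  rewrite -[leLHS](pair_mean_cst 0 M0); apply: pair_mean_le => l l'.
  by rewrite le_min !sn_ge0.
have sum_cst (P : pred 'I_r) (c : R) : 0 <= c -> \sum_(j | P j) f j * c <= r%:R * c.
  move=> c0; apply: (@le_trans _ _ (\sum_(j < r) c)).
    by rewrite big_mkcond; apply: ler_sum => j _; case: ifP => // _; rewrite ler_piMl.
  by rewrite sumr_const card_ord -[_ *+ _]mulr_natr mulrC.
have sumG : \sum_j f j * G j <= 2 / k * (d + r%:R * eta).
  have : \sum_j f j * pi j <= \sum_j f j * (part j v + B j - k / 2 * G j + eta).
    by apply: ler_sum => j _; rewrite ler_wpM2l.
  have -> : \sum_j f j * (part j v + B j - k / 2 * G j + eta) =
      \sum_j f j * part j v + \sum_j f j * B j - k / 2 * \sum_j f j * G j + \sum_j f j * eta.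
    rewrite mulr_sumr -big_split -sumrB -big_split /=; apply: eq_bigr => j _; lra.
  have := sum_cst predT _ eta0; move: sumv sumB fpi.
  set s1 := \sum_j _ * pi j; set s2 := \sum_j _ * part j v.
  set s3 := \sum_j _ * B j; set s4 := \sum_j _ * G j; set s5 := \sum_j _ => *.
  rewrite mulrAC ler_pdivlMr //; lra.
(* On [D] the vector [v] adds at most [theta]. Off [D] the differences, bounded by [b], are at most
   [1 + b / theta] times their minimum with [part j v], and these minima are small in total by
   [sumG]. *)
pose D : {set 'I_r} := [set j | part j v <= theta]%SET.
exists D; split.
  apply: (@le_trans _ _ (\sum_(j in D) f j * B j + \sum_(j in D) f j * (theta + eta))).
    rewrite -big_split; apply: ler_sum => j; rewrite inE => jD /=.
    rewrite -mulrDr ler_wpM2l //; have := piB j.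
    have : 0 <= k / 2 * G j by rewrite mulr_ge0 // divr_ge0 // ltW.
    lra.
  rewrite lerD //; last by apply: sum_cst; rewrite addr_ge0 // ltW.
  apply: le_trans sumB; rewrite [leRHS](bigID (fun j => j \in D)) /= lerDl.
  by apply: sumr_ge0 => j _; rewrite mulr_ge0.
have BG j : j \notin D -> B j <= (1 + b / theta) * G j.
  rewrite inE -ltNge => jv; rewrite /G -pair_meanZ; apply: pair_mean_le => l l'.
  have bt : 0 <= b / theta by rewrite divr_ge0 // ltW.
  have wbj : part j (w l - w l') <= b by exact: le_trans (part_le _ _) (wb _ _).
  have w0 := sn_ge0 (part j) (w l - w l').
  rewrite mulrDl mul1r; have [H|H] := leP (part j v) (part j (w l - w l')).
    have : b / theta * theta <= b / theta * part j v by rewrite ler_wpM2l // ltW.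
    rewrite mulfVK ?gt_eqF //; have := sn_ge0 (part j) v; lra.
  by rewrite lerDl mulr_ge0.
apply: (@le_trans _ _ (\sum_(j in ~: D) f j * part j v +
   (1 + b / theta) * (\sum_(j in ~: D) f j * G j) + \sum_(j in ~: D) f j * eta)).
  rewrite mulr_sumr -!big_split; apply: ler_sum => j; rewrite finset.in_setC => jD /=.
  have : f j * pi j <= f j * (part j v + (1 + b / theta) * G j + eta).
    rewrite ler_wpM2l //; have := piB j; have := BG j jD.
    have : 0 <= k / 2 * G j by rewrite mulr_ge0 // divr_ge0 // ltW.
    lra.
  lra.
have sub (H : 'I_r -> R) : (forall j, 0 <= H j) ->
    \sum_(j in ~: D) f j * H j <= \sum_j f j * H j.
  move=> H0; rewrite [leRHS](bigID (fun j => j \in ~: D)) /= lerDl.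
  by apply: sumr_ge0 => j _; rewrite mulr_ge0.
rewrite lerD ?sum_cst // lerD //.
  by apply: le_trans sumv; apply: sub => j; exact: sn_ge0.
rewrite ler_wpM2l ?addr_ge0 ?divr_ge0 // ?(ltW th0) //.
by apply: le_trans sumG; exact: sub.
Qed.

End Split.

Lemma convex_comb (R : realType) (E : lmodType R) (C : set E) n (t : 'I_n -> R) (F : 'I_n -> E) :
  convex_set C -> (forall l, 0 <= t l) -> \sum_l t l = 1 -> (forall l, C (F l)) ->
  C (\sum_l t l *: F l).
Proof.
move=> cC; elim: n t F => [|n IH] t F t0 t1 CF.
  by move/eqP: t1; rewrite big_ord0 eq_sym oner_eq0.
rewrite big_ord_recl in t1; rewrite big_ord_recl.
set b := \sum_(l < n) t (lift ord0 l) in t1.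
have b0 : 0 <= b by exact: sumr_ge0.
have [bz|bn0] := eqVneq b 0.
  have tz l : t (lift ord0 l) = 0.
    by have /psumr_eq0P -> : b = 0.
  rewrite big1 ?addr0; last by move=> l _; rewrite tz scale0r.
  by move: t1; rewrite bz addr0 => ->; rewrite scale1r.
have -> : \sum_(l < n) t (lift ord0 l) *: F (lift ord0 l) =
    (1 - t ord0) *: \sum_(l < n) (t (lift ord0 l) / b) *: F (lift ord0 l).
  rewrite -t1 addrC addKr scaler_sumr; apply: eq_bigr => l _.
  by rewrite scalerA mulrC mulfVK.
apply: cC => //; last by rewrite -t1 lerDl.
apply: IH => [l||l //]; first by rewrite divr_ge0.
by rewrite -mulr_suml mulfV.
Qed.

(** * A set at constant distance from its approximate fixed points has distance 0 *)

Section Diametral.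
Variables (R : realType) (E : lmodType R) (N : split_norm E).
Local Notation r := (rank N).
Local Notation k := (nsq N).
Variables (K : set E) (U : set_system E) (c : R).
Context {FU : UltraFilter U}.
Hypotheses (bK : body N K) (c0 : 0 < c) (UK : U K).
Hypothesis Uc : forall y (e : R), K y -> 0 < e -> U [set x | N (x - y) <= c + e].
Hypothesis far : forall z (e : R), K z -> 0 < e -> exists Psi : E -> E,
  [/\ maps_into K Psi, nonexpansive N K Psi, forall y, K y -> c - e <= N (Psi y - z) &
      forall d : R, 0 < d -> U [set x | N (Psi x - x) <= d]].

(* There are more weights than sets of coordinates. *)
Let m := #|{: {set 'I_r}}|.+1.
Let T : R := \sum_(l < m) l.+1%:R.
Let t (l : 'I_m) : R := l.+1%:R / T.

Let T_gt0 : 0 < T.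
Proof. by rewrite /T big_ord_recl ltr_pwDl ?ltr0n // sumr_ge0. Qed.

Let t_gt0 l : 0 < t l. Proof. by rewrite divr_gt0 ?ltr0n. Qed.

Let t_sum : \sum_l t l = 1.
Proof. by rewrite -mulr_suml mulfV // gt_eqF. Qed.

Let t_le1 l : t l <= 1.
Proof.
rewrite -t_sum (bigD1 l) //= lerDl sumr_ge0 // => i _; exact: ltW.
Qed.

Let comb (s : seq E) := \sum_l t l *: nth 0 s l.

Let comb_in s : size s = m -> all (fun x => `[< K x >]) s -> K (comb s).
Proof.
move=> sm /allP sK; have [_ cK _] := bK.
apply: convex_comb => // [l|l]; first exact: ltW.
by apply/asboolP/sK/mem_nth; rewrite sm.
Qed.

Section Index.
Variables (theta eta : R) (z : E) (Psi : E -> E) (f pi : 'I_r -> R).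
Hypotheses (th0 : 0 < theta) (eta0 : 0 < eta).
Hypothesis Psi_ne : nonexpansive N K Psi.
Hypothesis Psi_U : forall d : R, 0 < d -> U [set x | N (Psi x - x) <= d].
Hypothesis zlim : average_lim U N id z.
Hypotheses (f01 : forall j, 0 <= f j <= 1) (fN : forall x, \sum_j f j * part j x <= N x).
Hypothesis pilim : generic U m (fun s => forall j, `|part j (Psi (comb s) - z) - pi j| < eta).
Hypothesis fpi : c - (r%:R + 1) * eta <= \sum_j f j * pi j.

Let comb_cat s1 x s2 (i : 'I_m) : size s1 = i ->
  comb (s1 ++ x :: s2) = t i *: x + \sum_(l | l != i) t l *: nth 0 (s1 ++ 0 :: s2) l.
Proof.
move=> si; rewrite /comb (bigD1 i) //=; congr (_ *: _ + _).
  by rewrite nth_cat si ltnn subnn.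
apply: eq_bigr => l li; rewrite !nth_cat si; case: ltnP => // il.
have : (l - i)%N != 0%N by rewrite subn_eq0 -ltnNge ltn_neqAle il eq_sym -val_eqE andbT in li *.
by case: (l - i)%N.
Qed.

Lemma index_split (i : 'I_m) : exists D : {set 'I_r},
  \sum_(j in D) f j * pi j <= t i * (c + eta) + r%:R * (theta + eta) /\
  \sum_(j in ~: D) f j * pi j <= (1 - t i) * (c + eta) + 2 * eta +
     (1 + t i * (c + eta) / theta) * (2 / k * ((2 * r%:R + 4) * eta)) + r%:R * eta.
Proof.
have [_ cK _] := bK.
have [M M0 /(_ 1%N isT)] := zlim eta0; rewrite mul1n => GM.
(* The [i]-th entry of a sequence of length [m] is replaced by each of the [M] entries of a block
   [a] whose average is near [z]. *)
pose k' := (m - i.+1)%N; have mE : m = (i + (1 + k'))%N by rewrite addnA addn1 subnKC.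
pose rl (u v : E) := N (u - v) <= c + eta.
have rlC u v : rl u v = rl v u by rewrite /rl sn_distC.
have UK' : U [set x | `[< K x >]] by apply: filterS UK => x /asboolP.
have G1 : generic U (i + (M + k')) (fun s => pairwise rl s).
  apply: generic_pairwise; apply: filterS UK => x /Uc /(_ eta0).
  by apply: filterS => y /=; rewrite rlC.
have G2 := generic_all (FU := FU) (i + (M + k')) UK'.
have G3 := generic_all (FU := FU) M (Psi_U eta0).
have G4 : generic U i (fun s1 => generic U M (fun a => generic U k' (fun s2 =>
    forall l : 'I_M, forall j, `|part j (Psi (comb (s1 ++ nth 0 a l :: s2)) - z) - pi j| < eta))).
  have := pilim; rewrite {1}mE generic_cat; apply: genericS => s1 _ H.
  have : forall l : 'I_M, generic U M (fun a => generic U k' (fun s2 =>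
      forall j, `|part j (Psi (comb (s1 ++ nth 0 a l :: s2)) - z) - pi j| < eta)).
    move=> l; exact: (@generic_nth _ U FU 0 (fun x => generic U k' (fun s2 =>
      forall j, `|part j (Psi (comb (s1 ++ x :: s2)) - z) - pi j| < eta)) M l (ltn_ord l) H).
  by move=> /generic_forall; apply: genericS => a _ /generic_forall.
have [s1 ss1 [H1 H4]] := generic_ex (genericI
  ((generic_cat _ _ _).1 (genericI G1 G2)) G4).
have [a sa [[[H1' GMa] H3a] H4a]] := generic_ex (genericI (genericI (genericI
  ((generic_cat _ _ _).1 H1) GM) G3) H4).
have [s2 ss2 [[H1a H2a] Hpi]] := generic_ex (genericI H1' H4a).
pose w (l : 'I_M) := Psi (comb (s1 ++ nth 0 a l :: s2)).
pose al (l : 'I_M) := nth 0 a l.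
have al_in l : al l \in a by rewrite mem_nth // sa.
move: H2a; rewrite !all_cat => /and3P[K1 Ka K2].
have Kal l : K (al l) by apply/asboolP; exact: (allP Ka).
have Kcomb l : K (comb (s1 ++ al l :: s2)).
  apply: comb_in; first by rewrite size_cat /= ss1 ss2 -add1n -mE.
  by rewrite all_cat /= K1 K2 (introT (asboolP _) (Kal l)).
move: H1a; rewrite !pairwise_cat allrel_catr -!andbA => /and5P[r1a r12 _ ra2 /andP[raa _]].
have al_close l l' : l != l' -> rl (al l) (al l').
  move=> ll'; have /(pairwiseP 0) paa := raa.
  have : (l < l')%N || (l' < l)%N by rewrite -neq_ltn.
  by case/orP => lt; [|rewrite rlC]; apply: paa; rewrite // unfold_in /= sa.
have g_close l (l' : 'I_m) : l' != i -> rl (nth 0 (s1 ++ 0 :: s2) l') (al l).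
  move=> li; rewrite nth_cat ss1; case: ltnP => il.
    by move/allrelP: r1a; apply => //; rewrite mem_nth // ss1.
  have : (l' - i)%N != 0%N by rewrite subn_eq0 -ltnNge ltn_neqAle il eq_sym -val_eqE andbT in li *.
  case E' : (l' - i)%N => [//|q] _ /=; rewrite rlC.
  move/allrelP: ra2; apply => //; rewrite mem_nth // ss2 /k'.
  by rewrite ltn_subRL addSnnS -E' subnKC // ltn_ord.
have ce0 : 0 <= c + eta by rewrite addr_ge0 // ltW.
have t1i : \sum_(l | l != i) t l = 1 - t i.
  by have := t_sum; rewrite (bigD1 i) //= => <-; rewrite addrAC subrr add0r.
(* The defect [(r + 4) * eta] is what makes the two bounds add up, after subtraction, to the bound
   [c - (r + 1) * eta] of [fpi]. *)
have [//|//|||//|//||l l'|j l||D [D1 D2]] := @coordinates_split R E N M w z f pi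
  ((1 - t i) * (c + eta) + 2 * eta) (t i * (c + eta)) eta ((r%:R + 4) * eta) theta.
- by rewrite mulr_ge0 // ltW.
- exact: ltW.
- have -> : M%:R^-1 *: \sum_l w l - z = M%:R^-1 *: \sum_l (w l - al l) + (average id a - z).
    rewrite sumrB scalerBr addrA; congr (_ - _).
    by rewrite /average sa (big_nth 0) sa big_mkord subrK.
  have Hw l : N (w l - al l) <= (1 - t i) * (c + eta) + eta.
    apply: le_trans (sn_distD N (Psi (al l)) _ _) _; rewrite lerD //; last first.
      by move/allP: H3a; apply.
    apply: le_trans (Psi_ne (Kcomb l) (Kal l)) _.
    (* The [i]-th term cancels, and the other terms have total weight [1 - t i]. *)
    have -> : comb (s1 ++ al l :: s2) - al l =
       \sum_(l' | l' != i) t l' *: (nth 0 (s1 ++ 0 :: s2) l' - al l).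
      rewrite (comb_cat _ _ ss1); under [RHS]eq_bigr do rewrite scalerBr.
      rewrite sumrB -scaler_suml t1i scalerBl scale1r opprB addrC addrCA.
      by rewrite [RHS]addrCA; congr (_ + _); rewrite addrC.
    rewrite (le_trans (sn_sumZ _ _ _ _ _)) // => [l'|]; first exact: ltW.
    rewrite -t1i mulr_suml; apply: ler_sum => l' li; rewrite ler_wpM2l //; first exact: ltW.
    exact: g_close.
  apply: le_trans (snD _ _ _) _.
  have : N (M%:R^-1 *: \sum_l (w l - al l)) <= (1 - t i) * (c + eta) + eta.
    rewrite snZ_ge0 ?invr_ge0 // ler_pdivrMl ?ltr0n // (le_trans (sn_sum _ _ _ _)) //.
    rewrite -[M in M%:R]card_ord -sum1_card natr_sum mulr_suml ler_sum // => l _.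
    by rewrite mul1r.
  move: GMa; lra.
- have [->|ll'] := eqVneq l l'.
    by rewrite subrr sn0 mulr_ge0 // ltW.
  apply: le_trans (Psi_ne (Kcomb l) (Kcomb l')) _.
  rewrite !(comb_cat _ _ ss1) opprD addrACA subrr addr0 -scalerBr snZ_ge0; last exact: ltW.
  by apply: ler_wpM2l; [exact: ltW|exact: al_close].
- by have := Hpi l j; rewrite /w ltr_norml; lra.
- by move: fpi; lra.
exists D; split => //; apply: (le_trans D2).
by rewrite (_ : (r%:R + 4) * eta + r%:R * eta = (2 * r%:R + 4) * eta) //; lra.
Qed.

End Index.

Lemma no_diametral : False.
Proof.
have [[B KB] cK pK] := bK.
(* Two weights differ by at least [T^-1], so the masses [t i * c] are [3 * tau] apart; knowing each
   within [tau] separates them. *)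
pose tau := c / T / 3; have tau0 : 0 < tau by rewrite !divr_gt0.
have r1 : 0 < r%:R + 1 :> R by rewrite natr1 ltr0n.
have r0 : 0 <= r%:R :> R by [].
have k0 : 0 < k := nsq_gt0 N.
pose theta := tau / (2 * (r%:R + 1)).
have th0 : 0 < theta by rewrite divr_gt0 // mulr_gt0.
pose W := (1 + (c + 1) / theta) * (2 / k).
have W0 : 0 <= W.
  apply: mulr_ge0; last by rewrite divr_ge0 // ltW.
  by rewrite addr_ge0 // divr_ge0 ?(ltW th0) // addr_ge0 // ltW.
pose Q := (2 * r%:R + 4) * (1 + W).
have Q4 : 2 * r%:R + 4 <= Q by rewrite ler_peMr ?lerDl // addr_ge0 // mulr_ge0.
have Q0 : 0 < Q by apply: lt_le_trans Q4; lra.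
(* [Q * eta] collects the errors of [index_split] proportional to [eta]. The bound 1 lets [W],
   chosen before [eta], dominate the factor involving [c + eta]. *)
pose eta := Num.min 1 (tau / (2 * Q)).
have eta0 : 0 < eta by rewrite lt_min ltr01 divr_gt0 // mulr_gt0.
have eta1 : eta <= 1 by rewrite ge_min lexx.
have etaQ : eta * Q <= tau / 2.
  rewrite -ler_pdivlMr // ge_min; apply/orP; right.
  by rewrite invfM mulrA.
have [z Kz zlim] := average_lim_exists (x := id) bK UK.
have [Psi [PsiK Psi_ne Psi_far Psi_U]] := far Kz eta0.
have UK' : U [set x | `[< K x >]] by apply: filterS UK => x /asboolP.
have Gin := generic_all (FU := FU) m UK'.
have /choice[pi piP] (j : 'I_r) : exists l, forall e : R, 0 < e ->
    generic U m (fun s => `|part j (Psi (comb s) - z) - l| < e).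
  have [|l _ Hl] := @generic_lim R _ U _ m (fun s => part j (Psi (comb s) - z)) (2 * B);
    last by exists l.
  apply: genericS Gin => s sm sK; rewrite ger0_norm ?sn_ge0 //.
  rewrite (le_trans (part_le _ _)) // (le_trans (snB _ _ _)) //.
  have := KB _ (PsiK _ (comb_in sm sK)); have := KB _ Kz; lra.
have pilim : generic U m (fun s => forall j, `|part j (Psi (comb s) - z) - pi j| < eta).
  by apply: generic_forall => j; exact: piP.
have [s sm [sK spi]] := generic_ex (genericI Gin pilim).
have [f [f01 fx fN]] := dual N (Psi (comb s) - z).
have fpi : c - (r%:R + 1) * eta <= \sum_j f j * pi j.
  have := Psi_far _ (comb_in sm sK); rewrite -fx.
  have : \sum_j f j * part j (Psi (comb s) - z) <= \sum_j (f j * pi j + eta).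
    apply: ler_sum => j _; have := spi j; have /andP[f0 f1] := f01 j.
    rewrite ltr_norml => /andP[_ H]; have : f j * eta <= eta by rewrite ler_piMl // ltW.
    have : f j * part j (Psi (comb s) - z) <= f j * (pi j + eta) by rewrite ler_wpM2l //; lra.
    lra.
  rewrite big_split sumr_const card_ord -[eta *+ _]mulr_natr /=; lra.
(* The upper estimate is the bound on [D]; the lower one comes from the bound off [D] and [fpi]. *)
have /choice[D HD] (i : 'I_m) : exists D : {set 'I_r},
    `|\sum_(j in D) f j * pi j - t i * c| <= tau.
  have [D [D1 D2]] := index_split th0 eta0 Psi_ne Psi_U zlim f01 fN pilim fpi i.
  exists D; have t0 := t_gt0 i; have t1 := t_le1 i.
  have split_sum : \sum_j f j * pi j = \sum_(j in D) f j * pi j + \sum_(j in ~: D) f j * pi j.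
    rewrite (bigID (fun j => j \in D)) /=; congr (_ + _).
    by apply: eq_bigl => j; rewrite finset.in_setC.
  have te : t i * eta <= eta by rewrite ler_piMl // ltW.
  have te0 : 0 <= t i * eta by rewrite mulr_ge0 // ltW.
  have rth : r%:R * theta <= tau / 2.
    have : theta * (r%:R + 1) = tau / 2 by rewrite /theta invfM mulrA mulfVK // gt_eqF.
    lra.
  have Qe : (2 * r%:R + 4) * eta <= tau / 2.
    by apply: le_trans etaQ; rewrite [leRHS]mulrC ler_wpM2r // ltW.
  have re : 0 <= r%:R * eta by rewrite mulr_ge0 // ltW.
  rewrite ler_norml; apply/andP; split; last first.
    lra.
  have b1 : t i * (c + eta) <= c + 1.
    have : t i * (c + eta) <= c + eta by rewrite ler_piMl // addr_ge0 // ltW.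
    lra.
  have W1 : (1 + t i * (c + eta) / theta) * (2 / k * ((2 * r%:R + 4) * eta)) <=
      W * ((2 * r%:R + 4) * eta).
    rewrite mulrA ler_wpM2r ?mulr_ge0 ?(ltW eta0) ?addr_ge0 ?mulr_ge0 // ler_wpM2r //.
      by rewrite divr_ge0 // ltW.
    by rewrite lerD2l ler_wpM2r // invr_ge0 ltW.
  have QE : Q * eta = (2 * r%:R + 4) * eta + W * ((2 * r%:R + 4) * eta) by
    rewrite /Q mulrDr mulr1 mulrDl [_ * W]mulrC -(mulrA W).
  rewrite mulrC QE in etaQ; move: fpi; rewrite split_sum; lra.
have /injectivePn[i [l il Dil]] : ~~ injectiveb D.
  by apply/negP => /injectiveP /leq_card; rewrite card_ord ltnn.
have gap : T^-1 <= `|t i - t l|.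
  rewrite -mulrBl normrM (ger0_norm (_ : 0 <= T^-1)) ?invr_ge0 ?(ltW T_gt0) //.
  rewrite ler_peMl ?invr_ge0 ?(ltW T_gt0) //.
  have : (i < l)%N || (l < i)%N by rewrite -neq_ltn.
  case/orP => lt; [rewrite distrC|]; rewrite -natrB ?ltnS 1?ltnW //;
    by rewrite normr_nat ler1n subn_gt0.
have := HD i; have := HD l; rewrite -Dil; set s0 := \sum_(j in D i) _ => Hl Hi.
have : `|t i - t l| * c <= 2 * tau.
  rewrite -{1}(gtr0_norm c0) -normrM mulrBl.
  have := ler_distD s0 (t i * c) (t l * c); rewrite (distrC (t i * c) s0); lra.
have : T^-1 * c <= `|t i - t l| * c by rewrite ler_wpM2r // ltW.
have : 3 * tau = T^-1 * c by rewrite /tau; lra.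
lra.
Qed.

End Diametral.

(** * Minimal invariant sets *)
Section CommonFixedPoint.
Variables (R : realType) (E : lmodType R) (N : split_norm E).
Variables (J : Type) (S : J -> E -> E) (C : set E).
Hypotheses (bC : body N C) (C0 : C !=set0).
Hypotheses (SC : forall j, maps_into C (S j)) (Sne : forall j, nonexpansive N C (S j)).

Definition invariant K := [/\ closed_in N C K, convex_set K, K !=set0 &
  forall j, maps_into K (S j)].

(** Zorn's lemma without weak compactness: choose a point in each member of a chain; the limit of
    averages of these points along an ultrafilter of tails lies in every member. *)
Lemma minimal_invariant : exists2 K, invariant K &
  forall L, invariant L -> L `<=` K -> K `<=` L.
Proof.
have [_ cC _] := bC.
have invC : invariant C by split => //; split.
pose Tp := {K | invariant K}; pose Rl (K L : Tp) := `[< sval L `<=` sval K >].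
have [| | |[K iK] Kmax] := @ZL_preorder Tp (exist _ C invC) Rl.
- by move=> K; apply/asboolP; exact: subset_refl.
- move=> K L M /asboolP LK /asboolP ML; apply/asboolP; exact: subset_trans LK.
- move=> A totA; have [[K0 AK0]|nA] := pselect (A !=set0); last first.
    by exists (exist _ C invC) => K AK; case: nA; exists K.
  have /choice[x xP] (K : Tp) : exists x0, sval K x0 by have [_ _ [x0 ?] _] := svalP K; exists x0.
  pose B (K : Tp) := [set L : Tp | A L /\ sval L `<=` sval K].
  have FF : ProperFilter (filter_from A B).
    apply: filter_from_proper; last by move=> K AK; exists K; split => // ?.
    apply: filter_from_filter; first by exists K0.
    move=> K L AK AL; have [/asboolP H|/asboolP H] := totA K L AK AL.
      by exists L => // M [AM ML]; split; split => //; apply: subset_trans H.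
    by exists K => // M [AM MK]; split; split => //; apply: subset_trans H.
  have [U [UU FU]] := ultraFilterLemma FF.
  have UA K : A K -> U [set L | sval K (x L)].
    by move=> AK; apply: FU; exists K => // L [AL LK]; exact/LK/xP.
  have UC : U [set L | C (x L)].
    by apply: filterS (UA _ AK0) => L; case: (svalP K0) => -[KC _] _ _ _ /KC.
  have [z Cz zlim] := average_lim_exists bC UC.
  have zA K : A K -> sval K z.
    move=> AK; have [clK cK _ _] := svalP K.
    exact: (average_lim_closed cK clK (UA _ AK) Cz zlim).
  have iI : invariant (\bigcap_(K in A) sval K).
    split.
    - split; first by move=> y /(_ _ AK0); case: (svalP K0) => -[KC _] _ _ _ /KC.
      move=> y Cy Hy K AK; have [[_ clK] _ _ _] := svalP K; apply: clK => // e e0.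
      by have [y' y'I yy'] := Hy e e0; exists y' => //; exact: y'I.
    - move=> y y' t yI y'I t0 t1 K AK; have [_ cK _ _] := svalP K.
      by apply: cK => //; [exact: yI|exact: y'I].
    - by exists z.
    - move=> j y yI K AK; have [_ _ _ SK] := svalP K; exact/SK/yI.
  by exists (exist _ _ iI) => K AK; apply/asboolP => y /(_ _ AK).
exists K => // L iL LK; have := Kmax (exist _ L iL); rewrite /Rl => H.
by have /asboolP := H (introT (asboolP _) LK).
Qed.

(* AA is a base of "sets of approximate common fixed points". *)
Variable AA : set (set E).
Hypothesis AA_dir : forall A A', AA A -> AA A' -> exists2 D, AA D & D `<=` A `&` A'.
Hypothesis AA0 : AA !=set0.
Hypothesis AA_fix : forall j (d : R), 0 < d -> exists2 A, AA A &
  forall y, C y -> A y -> N (S j y - y) <= d.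
(** The map [Psi] will be an iterate of [halfway S] or a retraction onto common fixed points. *)
Hypothesis AA_map : forall A K, AA A -> invariant K -> exists Psi,
  [/\ maps_into K Psi, nonexpansive N K Psi, forall y, K y -> A (Psi y) &
      forall d : R, 0 < d -> exists2 A', AA A' &
        forall y, K y -> A' y -> N (Psi y - y) <= d].

(** On a minimal [K] the asymptotic distance [c z] to approximate common fixed points is constant. A
    positive constant contradicts [no_diametral]; otherwise such points accumulate at every point of
    [K]. *)
Lemma common_fixed_point : exists2 x, C x & forall j, N (S j x - x) = 0.
Proof.
have [[B CB] cC pC] := bC.
have [K iK Kmin] := minimal_invariant.
have [[KC clK] cK [z0 Kz0] SK] := iK.
have bK : body N K by apply: closed_in_body bC _ cK.
have KA0 A : AA A -> exists2 y, K y & A y.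
  by move=> AAA; have [Psi [PK _ PA _]] := AA_map AAA iK; exists (Psi z0); auto.
pose dist z A := inf [set N (y - z) | y in K `&` A].
have distS z A : AA A -> has_inf [set N (y - z) | y in K `&` A].
  move=> AAA; split; last by exists 0 => _ [y _ <-]; exact: sn_ge0.
  by have [y Ky Ay] := KA0 A AAA; exists (N (y - z)), y.
have dist_le z A y : AA A -> K y -> A y -> dist z A <= N (y - z).
  by move=> AAA Ky Ay; apply: ge_inf; [exact: (distS z A AAA).2|exists y].
pose c z := sup [set dist z A | A in AA].
have dist_ub z : K z -> has_sup [set dist z A | A in AA].
  move=> Kz; split; first by have [A AAA] := AA0; exists (dist z A), A.
  exists (2 * B) => _ [A AAA <-]; have [y Ky Ay] := KA0 A AAA.
  apply: le_trans (dist_le z A y AAA Ky Ay) _; apply: le_trans (snB _ _ _) _.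
  have := CB _ (KC _ Ky); have := CB _ (KC _ Kz); lra.
have dist_c z A : K z -> AA A -> dist z A <= c z.
  by move=> Kz AAA; apply: ub_le_sup; [exact: (dist_ub z Kz).2|exists A].
pose Bs z (q : set E * R) := [set y | [/\ K y, q.1 y & N (y - z) <= c z + q.2]].
have near_ultra z : K z -> exists U : set_system E, [/\ UltraFilter U, U K,
    forall A, AA A -> U A & forall e : R, 0 < e -> U [set y | N (y - z) <= c z + e]].
  move=> Kz; pose D := [set q : set E * R | AA q.1 /\ 0 < q.2].
  have [A0 AAA0] := AA0.
  have FF : ProperFilter (filter_from D (Bs z)).
    apply: filter_from_proper; last first.
      move=> [A e] [AAA e0]; rewrite /= in AAA e0.
      have [_ [y [Ky Ay] <-] yA] := inf_adherent e0 (distS z A AAA).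
      by exists y; split => //=; apply: ltW; apply: lt_le_trans yA _; rewrite lerD2r dist_c.
    apply: filter_from_filter; first by exists (A0, 1).
    move=> [A e] [A' e'] [/= AAA e0] [/= AAA' e0'].
    have [A'' AAA'' sA] := AA_dir AAA AAA'.
    exists (A'', Num.min e e') => /=; first by split => //=; rewrite lt_min e0.
    move=> y [/= Ky /sA[Ay A'y]]; rewrite -lerBlDl le_min !lerBlDl => /andP[ye ye'].
    by split.
  have [U [UU FU]] := ultraFilterLemma FF; exists U; split => //.
  - by apply: FU; exists (A0, 1) => // y [].
  - by move=> A AAA; apply: FU; exists (A, 1) => // y [].
  - by move=> e e0; apply: FU; exists (A0, e) => // y [].
(* The points within [rho] of almost all [x] form an invariant set, since each [S j] almost fixes
   these [x]; by minimality this set is all of [K]. *)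
have level_inv (U : set_system E) (rho : R) : UltraFilter U -> U K -> (forall A, AA A -> U A) ->
    (exists2 y, K y & forall e, 0 < e -> U [set x | N (x - y) <= rho + e]) ->
    forall y, K y -> forall e, 0 < e -> U [set x | N (x - y) <= rho + e].
  move=> UU UK UA [y1 Ky1 Hy1].
  pose L := [set y | K y /\ forall e, 0 < e -> U [set x | N (x - y) <= rho + e]].
  suff iL : invariant L by move=> y Ky; case: (Kmin L iL (fun y H => H.1) y Ky).
  split.
  - split; first by move=> y [/KC].
    move=> y Cy Hy; split; first by apply: clK => // e /Hy[y' [Ky' _] yy']; exists y'.
    move=> e e0; have e2 : 0 < e / 2 by rewrite divr_gt0.
    have [y' [_ /(_ _ e2) Hy'] yy'] := Hy _ e2.
    apply: filterS Hy' => x /= Hx; have := sn_distD N y' x y.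
    rewrite (sn_distC N y' y); lra.
  - move=> y y' t [Ky Hy] [Ky' Hy'] t0 t1; split; first exact: cK.
    move=> e e0; apply: filterS2 (Hy _ e0) (Hy' _ e0) => x /= H H'.
    have -> : x - (t *: y + (1 - t) *: y') = t *: (x - y) + (1 - t) *: (x - y').
      rewrite !scalerBr addrACA -scalerDl (_ : t + (1 - t) = 1); last by lra.
      by rewrite scale1r opprD.
    apply: le_trans (snD _ _ _) _; rewrite !snZ_ge0 //; last by rewrite subr_ge0.
    have := ler_wpM2l t0 H; have : (1 - t) * N (x - y') <= (1 - t) * (rho + e).
      by rewrite ler_wpM2l // subr_ge0.
    lra.
  - by exists y1.
  - move=> j y [Ky Hy]; split; first exact: SK.
    move=> e e0; have e2 : 0 < e / 2 by rewrite divr_gt0.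
    have [A AAA HA] := AA_fix j e2.
    apply: filterS3 UK (UA _ AAA) (Hy _ e2) => x Kx Ax /= H.
    have := HA x (KC _ Kx) Ax; have := @Sne j _ _ (KC _ Kx) (KC _ Ky).
    have := sn_distD N (S j x) x (S j y); rewrite (sn_distC N x (S j x)); lra.
have c_const z z' : K z -> K z' -> c z' <= c z.
  move=> Kz Kz'; have [U [UU UK UA Uz]] := near_ultra z Kz.
  apply: ge_sup; first by have [A AAA] := AA0; exists (dist z' A), A.
  move=> _ [A AAA <-]; apply/ler_addgt0Pr => e e0.
  have H := level_inv U (c z) UU UK UA (ex_intro2 _ _ z Kz Uz) z' Kz' e e0.
  have [x [[Kx Ax] xz']] := filter_ex (filterI (filterI UK (UA A AAA)) H).
  exact: le_trans (dist_le z' A x AAA Kx Ax) xz'.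
have [U [UU UK UA Uz0]] := near_ultra z0 Kz0.
have Uc y (e : R) : K y -> 0 < e -> U [set x | N (x - y) <= c z0 + e].
  by move=> Ky; exact: (level_inv U (c z0) UU UK UA (ex_intro2 _ _ z0 Kz0 Uz0) y Ky).
have [c0|c0] := ltP 0 (c z0).
  exfalso; apply: (no_diametral bK c0 UK Uc) => z e Kz e0.
  have cz : c z = c z0 by apply/eqP; rewrite eq_le !c_const.
  have [_ [A AAA <-] Ae] := sup_adherent e0 (dist_ub z Kz).
  have [Psi [PK Pne PA Pfix]] := AA_map AAA iK.
  exists Psi; split => //.
    move=> y Ky; apply: le_trans (dist_le z A _ AAA (PK _ Ky) (PA _ Ky)).
    by rewrite -cz ltW.
  move=> d d0; have [A' AAA' HA'] := Pfix d d0.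
  by apply: filterS2 UK (UA _ AAA') => y Ky A'y; exact: HA'.
exists z0; first exact: KC.
move=> j; apply/eqP; rewrite eq_le sn_ge0 andbT; apply/ler_addgt0Pr => e e0.
have e4 : 0 < e / 4 by rewrite divr_gt0.
have [A AAA HA] := AA_fix j e4.
have [x [[Kx Ax] xz]] := filter_ex (filterI (filterI UK (UA _ AAA)) (Uc _ _ Kz0 e4)).
have := HA x (KC _ Kx) Ax; have := @Sne j _ _ (KC _ Kx) (KC _ Kz0).
have := sn_distD N (S j x) (S j z0) z0; have := sn_distD N x (S j x) z0.
rewrite (sn_distC N (S j z0) (S j x)); move: xz; rewrite /=; lra.
Qed.

End CommonFixedPoint.

(** * Commuting families *)
Section SingleMap.
Variables (R : realType) (E : lmodType R) (N : split_norm E).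

(** Asymptotic regularity is uniform, so one iterate of [halfway S] sends a whole invariant set to
    points moved by at most [e], and it hardly moves points that are almost fixed. *)
Lemma fixed_point (C : set E) (S : E -> E) : body N C -> C !=set0 ->
  maps_into C S -> nonexpansive N C S -> exists2 x, C x & N (S x - x) = 0.
Proof.
move=> bC C0 SC Sne.
pose AA := [set [set y | N (S y - y) <= e] | e in [set e : R | 0 < e]].
have [||||x Cx Hx] := @common_fixed_point R E N unit (fun=> S) C bC C0 (fun=> SC) (fun=> Sne) AA.
- move=> _ _ [e e0 <-] [e' e'0 <-].
  exists [set y | N (S y - y) <= Num.min e e'].
    by exists (Num.min e e') => //=; rewrite lt_min; apply/andP.
  by move=> y /=; rewrite le_min => /andP[].
- by exists [set y | N (S y - y) <= 1]; exists 1 => /=.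
- by move=> _ d d0; exists [set y | N (S y - y) <= d] => //; exists d.
- move=> _ K [e e0 <-] [[KC clK] cK K0 SK].
  have [[B CB] _ _] := bC.
  have KB : bounded_by N B K by move=> y /KC /CB.
  have KS : maps_into K S := SK tt.
  have Kne : nonexpansive N K S by move=> x y /KC Cx /KC Cy; exact: Sne.
  have [n Hn] := asymptotic_regularity KB cK KS Kne e0.
  exists (iter n (halfway S)); split => //.
  - exact: iter_halfway_into.
  - exact: iter_halfway_nonexpansive.
  - move=> d d0; have dn : 0 < d / n.+1%:R by rewrite divr_gt0 // ltr0n.
    exists [set y | N (S y - y) <= d / n.+1%:R]; first by exists (d / n.+1%:R).
    move=> y Ky /= Hy; apply: le_trans (iter_halfway_dist cK KS Kne n Ky) _.
    apply: (@le_trans _ _ (n.+1%:R * (d / n.+1%:R))); last by rewrite mulrC mulfVK ?pnatr_eq0.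
    by rewrite ler_pM ?sn_ge0 // ler_nat.
by exists x => //; exact: (Hx tt).
Qed.

End SingleMap.

(** * Bruck's nonexpansive retraction onto the common fixed points *)

Section Retraction.
Variables (R : realType) (E : lmodType R) (N : split_norm E).
Variables (J : Type) (S : J -> E -> E) (K : set E).
Hypotheses (bK : body N K).
Hypotheses (SK : forall j, maps_into K (S j)) (Sne : forall j, nonexpansive N K (S j)).

Let fixed := [set y | forall j, N (S j y - y) = 0].

Hypothesis fixedP : forall L, invariant N S K L -> exists2 x, L x & fixed x.

Let G (f : E -> E) := [/\ maps_into K f, nonexpansive N K f &
  forall y, K y -> fixed y -> N (f y - y) = 0].

(* Bruck's minimal element: every g in G is isometric on the range of r. *)
Let minimal_map : exists2 r, G r & forall g x y, G g -> K x -> K y ->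
  N (r x - r y) <= N (g (r x) - g (r y)).
Proof.
have Gid : G id by split => // y _ _; rewrite subrr sn0.
pose Tp := {f | G f}.
(* Maps shrinking distances more are higher. A chain is bounded by its pointwise limit of averages,
   which stays in [G]. *)
pose Rl (f g : Tp) := `[< forall x y, K x -> K y -> N (sval g x - sval g y) <= N (sval f x - sval f y) >].
have [| | |[r Gr] rmin] := @ZL_preorder Tp (exist _ _ Gid) Rl.
- by move=> f; apply/asboolP.
- move=> f g h /asboolP gf /asboolP fh; apply/asboolP => x y Kx Ky.
  exact: le_trans (fh x y Kx Ky) (gf x y Kx Ky).
- move=> A totA; have [[f0 Af0]|nA] := pselect (A !=set0); last first.
    by exists (exist _ _ Gid) => f Af; case: nA; exists f.
  pose B (f : Tp) := [set g : Tp | A g /\ Rl f g].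
  have FF : ProperFilter (filter_from A B).
    apply: filter_from_proper.
      apply: filter_from_filter; first by exists f0.
      have trans f g h : Rl f g -> Rl g h -> Rl f h.
        move=> /asboolP fg /asboolP gh; apply/asboolP => x y Kx Ky.
        exact: le_trans (gh x y Kx Ky) (fg x y Kx Ky).
      move=> f g Af Ag; have [fg|gf] := totA f g Af Ag.
        by exists g => // h [Ah gh]; split; split => //; exact: trans gh.
      by exists f => // h [Ah fh]; split; split => //; exact: trans fh.
    by move=> f Af; exists f; split => //; apply/asboolP.
  have [U [UU FU]] := ultraFilterLemma FF.
  have UK y : K y -> U [set f | K (sval f y)].
    by move=> Ky; apply: filterE => f; case: (svalP f) => fK _ _; exact: fK.
  have /choice[l lP] (y : E) : exists z, K y ->
      K z /\ average_lim U N (fun f : Tp => sval f y) z.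
    have [Ky|nKy] := pselect (K y); last by exists 0.
    by have [z Kz zlim] := average_lim_exists bK (UK y Ky); exists z.
  have lim_le f x y : A f -> K x -> K y -> N (l x - l y) <= N (sval f x - sval f y).
    move=> Af Kx Ky; have [_ lx] := lP x Kx; have [_ ly] := lP y Ky.
    apply: (average_lim_dist lx ly); apply: FU; exists f => // g [_ /asboolP H] /=.
    exact: H.
  have Gl : G l.
    split.
    - by move=> y Ky; case: (lP y Ky).
    - move=> x y Kx Ky; apply: le_trans (lim_le f0 x y Af0 Kx Ky) _.
      by case: (svalP f0) => _ f0ne _; exact: f0ne.
    - move=> y Ky fy; have [_ ly] := lP y Ky.
      apply/eqP; rewrite eq_le sn_ge0 andbT.
      apply: (@average_lim_dist _ _ _ U _ N _ (fun=> y) _ y _ ly).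
        move=> e e0; exists 1%N => // q q0; apply: genericT => s sn.
        by rewrite average_cst ?sn ?muln1 // subrr sn0 ltW.
      apply: filterE => f /=; case: (svalP f) => _ _ Hf.
      by rewrite Hf.
  exists (exist _ _ Gl) => f Af; apply/asboolP => x y Kx Ky; exact: lim_le.
exists r => // g x y Gg Kx Ky.
have [rK rne rfix] := Gr; have [gK gne gfix] := Gg.
have Ggr : G (g \o r).
  split => [z Kz|z w Kz Kw|z Kz fz]; first exact/gK/rK.
    exact: le_trans (gne _ _ (rK _ Kz) (rK _ Kw)) (rne _ _ Kz Kw).
  apply/eqP; rewrite eq_le sn_ge0 andbT; apply: le_trans (sn_distD N (g z) _ _) _.
  by rewrite (gfix z) // addr0 /= -(rfix z) // gne //; exact: rK.
have := rmin (exist _ _ Ggr); rewrite /Rl => H.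
have /asboolP := H (introT (asboolP _)
  (fun z w Kz Kw => gne _ _ (rK z Kz) (rK w Kw))).
exact.
Qed.

(** The closure [H] of the points [g (r x)], with [g] in [G], is invariant and so contains a common
    fixed point [p]. No [g] brings [r x] nearer to [r p], which is at distance 0 from [p]; yet some
    [g (r x)] is arbitrarily near [p]. Hence [r x] is itself fixed. *)
Lemma nonexpansive_retraction : exists r, [/\ maps_into K r, nonexpansive N K r,
  forall y, K y -> fixed (r y) & forall y, K y -> fixed y -> N (r y - y) = 0].
Proof.
have [r Gr rmin] := minimal_map; have [rK rne rfix] := Gr.
exists r; split => // x Kx.
have [_ cK _] := bK.
pose H := [set y | K y /\ forall e : R, 0 < e -> exists2 g, G g & N (g (r x) - y) < e].
have Gmix f g t : G f -> G g -> 0 <= t -> t <= 1 -> G (fun y => t *: f y + (1 - t) *: g y).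
  move=> [fK fne ffix] [gK gne gfix] t0 t1; have t1' : 0 <= 1 - t by rewrite subr_ge0.
  have mix a b a' b' : N (t *: a + (1 - t) *: b - (t *: a' + (1 - t) *: b')) <=
      t * N (a - a') + (1 - t) * N (b - b').
    by rewrite opprD addrACA -!scalerBr (le_trans (snD _ _ _)) // !snZ_ge0.
  split.
  - by move=> y Ky; apply: cK => //; [exact: fK|exact: gK].
  - move=> y z Ky Kz; apply: le_trans (mix _ _ _ _) _.
    have := ler_wpM2l t0 (fne _ _ Ky Kz); have := ler_wpM2l t1' (gne _ _ Ky Kz); lra.
  - move=> y Ky fy; apply/eqP; rewrite eq_le sn_ge0 andbT.
    have yE : y = t *: y + (1 - t) *: y by rewrite -scalerDl addrC subrK scale1r.
    by rewrite {3}yE (le_trans (mix _ _ _ _)) // ffix // gfix // !mulr0 addr0.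
have [|p Hp fp] := fixedP (L := H).
  split.
  - split; first by move=> y [].
    move=> y Ky Hy; split => // e e0; have e2 : 0 < e / 2 by rewrite divr_gt0.
    have [y' [_ /(_ _ e2)[g Gg gy']] yy'] := Hy _ e2; exists g => //.
    by have := sn_distD N y' (g (r x)) y; rewrite (sn_distC N y' y); lra.
  - move=> y z t [Ky Hy] [Kz Hz] t0 t1; split; first exact: cK.
    move=> e e0; have e2 : 0 < e / 2 by rewrite divr_gt0.
    have [g Gg gy] := Hy _ e2; have [h Gh hz] := Hz _ e2.
    exists (fun y => t *: g y + (1 - t) *: h y); first exact: Gmix.
    rewrite opprD addrACA -!scalerBr (le_lt_trans (snD _ _ _)) // !snZ_ge0 //; last lra.
    have : t * N (g (r x) - y) <= t * (e / 2) by rewrite ler_wpM2l // ltW.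
    have : (1 - t) * N (h (r x) - z) <= (1 - t) * (e / 2) by rewrite ler_wpM2l ?subr_ge0 // ltW.
    lra.
  - exists (r x); split; first exact: rK.
    by move=> e e0; exists id; rewrite ?subrr ?sn0 //; split => // y _ _; rewrite subrr sn0.
  - move=> j y [Ky Hy]; split; first exact: SK.
    move=> e e0; have [g [gK gne gfix] gy] := Hy e e0.
    exists (S j \o g).
      split => [z Kz|z w Kz Kw|z Kz fz]; first exact/SK/gK.
        by apply: le_trans (gne _ _ Kz Kw); apply: Sne; exact: gK.
      apply/eqP; rewrite eq_le sn_ge0 andbT; apply: le_trans (sn_distD N (S j z) _ _) _.
      by rewrite (fz j) addr0 /= -(gfix z) // Sne //; exact: gK.
    by apply: le_lt_trans gy; apply: Sne => //; exact/gK/rK.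
have [Kp Hp'] := Hp.
suff rxp : N (r x - p) = 0.
  move=> j; apply/eqP; rewrite eq_le sn_ge0 andbT.
  have := sn_distD N (S j p) (S j (r x)) (r x); have := sn_distD N p (S j p) (r x).
  have := @Sne j _ _ (rK _ Kx) Kp; rewrite (sn_distC N p (r x)) (fp j) rxp; lra.
apply/eqP; rewrite eq_le sn_ge0 andbT; apply/ler_addgt0Pr => e e0; rewrite add0r.
have [g Gg gx] := Hp' e e0; have [gK gne gfix] := Gg.
have rp := rfix p Kp fp.
have grp : N (g (r p) - p) = 0.
  apply/eqP; rewrite eq_le sn_ge0 andbT; apply: le_trans (sn_distD N (g p) _ _) _.
  by rewrite (gfix p) // addr0 -rp gne //; exact: rK.
have := rmin g x p Gg Kx Kp; have := sn_distD N p (g (r x)) (g (r p)).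
have := sn_distD N (r p) (r x) p; rewrite (sn_distC N p (g (r p))) grp rp; lra.
Qed.

End Retraction.

Section Families.
Variables (R : realType) (E : lmodType R) (N : split_norm E).
Variables (J : Type) (S : J -> E -> E) (C : set E).
Hypotheses (bC : body N C).
Hypotheses (SC : forall j, maps_into C (S j)) (Sne : forall j, nonexpansive N C (S j)).
Hypothesis Scomm : forall i j x, C x -> S i (S j x) = S j (S i x).

Let fixed (l : seq J) := [set y | forall j, List.In j l -> N (S j y - y) = 0].

Let sub (l : seq J) (j : {j | List.In j l}) := S (sval j).

(** Let [r] retract onto the fixed points of [l] and let [y] be fixed by [S i \o r]. By commutation
    [S i] preserves the fixed points of [l], so [y] is one of them; then [r y] is at distance 0 from
    [y], and [y] is fixed by [S i] too. *)
Lemma finite_common_fixed_point l K : closed_in N C K -> convex_set K -> K !=set0 ->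
  (forall j, List.In j l -> maps_into K (S j)) -> exists2 x, K x & fixed l x.
Proof.
elim: l K => [|i l IH] K clK cK K0 SK; first by have [x Kx] := K0; exists x => // j [].
have KC := clK.1; have bK := closed_in_body bC clK cK.
have SK' (j : {j | List.In j l}) : maps_into K (sub j).
  exact: (SK (sval j) (or_intror (svalP j))).
have Sne' (j : {j | List.In j l}) : nonexpansive N K (sub j).
  by move=> x y /KC Cx /KC Cy; exact: Sne.
have [|r [rK rne rfix fixr]] := nonexpansive_retraction bK SK' Sne'.
  move=> L [[LK clL] cL L0 SL].
  have [|j jl|x Lx fx] := IH L _ cL L0.
  - split; first by move=> x /LK /KC.
    move=> x Cx Hx; apply: clL => //; apply: clK.2 => // e /Hx[y Ly xy].
    by exists y => //; exact: LK.
  - exact: (SL (exist _ j jl)).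
  - by exists x => // -[j jl]; exact: fx.
have SiK : maps_into K (S i) by apply: SK; left.
have [|x y Kx Ky|y Ky Hy] := @fixed_point _ _ N K (S i \o r) bK K0.
- by move=> x Kx; exact/SiK/rK.
- by apply: le_trans (rne _ _ Kx Ky); apply: Sne; apply/KC/rK.
have Kry := rK _ Ky; have Cry := KC _ Kry; have Cy := KC _ Ky.
have CSry : C (S i (r y)) by exact: SC.
have fy (j : {j | List.In j l}) : N (sub j y - y) = 0.
  have H1 : N (sub j (S i (r y)) - S i (r y)) = 0.
    rewrite /sub Scomm //; apply/eqP; rewrite eq_le sn_ge0 andbT -(rfix y Ky j).
    by apply: Sne => //; exact: SC.
  apply/eqP; rewrite eq_le sn_ge0 andbT.
  have := sn_distD N (sub j (S i (r y))) (sub j y) y.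
  have := sn_distD N (S i (r y)) (sub j (S i (r y))) y.
  have := @Sne (sval j) _ _ Cy CSry; rewrite (sn_distC N y) -/(sub j) H1 Hy; lra.
have ry := fixr y Ky fy.
exists y => // j [<-|jl]; last exact: (fy (exist _ j jl)).
apply/eqP; rewrite eq_le sn_ge0 andbT.
have := sn_distD N (S i (r y)) (S i y) y; have := @Sne i _ _ Cy Cry.
by rewrite (sn_distC N y) ry /= in Hy *; rewrite Hy; lra.
Qed.

(** The base consists of the common fixed point sets of finite subfamilies, and [Psi] is the
    retraction onto such a set. *)
Lemma commuting_common_fixed_point : C !=set0 ->
  exists2 x, C x & forall j, N (S j x - x) = 0.
Proof.
move=> C0; pose AA := range fixed.
apply: (@common_fixed_point R E N J S C bC C0 SC Sne AA).
- move=> _ _ [l _ <-] [l' _ <-]; exists (fixed (l ++ l')); first by exists (l ++ l').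
  by move=> y fy; split => j jl; apply: fy; apply: List.in_or_app; [left|right].
- by exists (fixed [::]); exists [::].
- move=> j d d0; exists (fixed [:: j]); first by exists [:: j].
  by move=> y _ /(_ j) ->; [exact: ltW|left].
- move=> _ K [l _ <-] [clK cK K0 SK].
  have KC := clK.1; have bK := closed_in_body bC clK cK.
  have [|||r [rK rne rfix fixr]] := @nonexpansive_retraction _ _ N _ (@sub l) K bK.
  + by move=> j; exact: SK.
  + by move=> j x y /KC Cx /KC Cy; exact: Sne.
  + move=> L [[LK clL] cL L0 SL].
    have [|j jl|x Lx fx] := @finite_common_fixed_point l L _ cL L0.
    * split; first by move=> x /LK /KC.
      move=> x Cx Hx; apply: clL => //; apply: clK.2 => // e /Hx[y Ly xy].
      by exists y => //; exact: LK.
    * exact: (SL (exist _ j jl)).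
    * by exists x => // -[j jl]; exact: fx.
  exists r; split => //.
  + by move=> y Ky j jl; exact: (rfix y Ky (exist _ j jl)).
  + move=> d d0; exists (fixed l); first by exists l.
    by move=> y Ky fy; rewrite fixr ?ltW // => -[j jl]; exact: fy.
Qed.

End Families.

(** * Ultrapowers *)
Section Pullback.
Variables (R : realType) (I : Type) (U : set_system I).
Context {FU : UltraFilter U}.
Variables (F G : lmodType R) (T : I -> F -> G).
(** Only eventual linearity is asked: finite representability gives maps linear on one
    finite-dimensional subspace at a time. *)
Hypothesis Tlin : forall (a : R) x y, U [set i | T i (a *: x + y) = a *: T i x + T i y].

Lemma ultra_cvg (f : I -> R) (B : R) : U [set i | `|f i| <= B] ->
  exists l : R, f i @[i --> U] --> l.
Proof.
move=> /ultra_lim[l _ Hl]; exists l; apply/pseudometric_normed_Zmodule.cvgrPdist_lt => e e0.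
by apply: filterS (Hl e e0) => i; rewrite /= distrC.
Qed.

Let lim_le (f g : I -> R) (a b : R) : f i @[i --> U] --> a -> g i @[i --> U] --> b ->
  U [set i | f i <= g i] -> a <= b.
Proof.
move=> fa gb fg; rewrite -subr_le0; apply: (cvgr_to_le (cvgB fa gb)).
by apply: (@filterS _ U _ _ _ _ fg) => i /=; rewrite subr_le0.
Qed.

Let TD x y : U [set i | T i (x + y) = T i x + T i y].
Proof. by have := Tlin 1 x y; apply: filterS => i /=; rewrite !scale1r. Qed.

Let TZ a x : U [set i | T i (a *: x) = a *: T i x].
Proof.
have := TD 0 0; have := Tlin a x 0; apply: filterS2 => i /=.
rewrite !addr0 => -> /eqP; rewrite -subr_eq0 opprD addNKr oppr_eq0 => /eqP ->.
by rewrite addr0.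
Qed.

Lemma seminorm_pullback (p : seminorm G) : (forall x, exists B, U [set i | p (T i x) <= B]) ->
  exists q : seminorm F, forall x, p (T i x) @[i --> U] --> q x.
Proof.
move=> pB; have /choice[q qP] (x : F) : exists l : R, p (T i x) @[i --> U] --> l.
  have [B xB] := pB x; apply: (@ultra_cvg (fun i => p (T i x)) B).
  by apply: filterS xB => i /= xB; rewrite ger0_norm ?sn_ge0.
have qD x y : q (x + y) <= q x + q y.
  apply: (lim_le (qP (x + y)) (cvgD (qP x) (qP y))).
  by apply: (@filterS _ U _ _ _ _ (TD x y)) => i /= ->; exact: snD.
have qZ a x : q (a *: x) = `|a| * q x.
  have H : `|a| * p (T i x) @[i --> U] --> `|a| * q x by exact: cvgMl_tmp.
  apply/eqP; rewrite eq_le; apply/andP; split.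
    apply: (lim_le (qP (a *: x)) H).
    by apply: (@filterS _ U _ _ _ _ (TZ a x)) => i /= ->; rewrite snZ.
  apply: (lim_le H (qP (a *: x))).
  by apply: (@filterS _ U _ _ _ _ (TZ a x)) => i /= ->; rewrite snZ.
by exists (Seminorm qD qZ).
Qed.

(** All clauses are inequalities between finitely many seminorms and pass to limits; norming
    functionals converge since their coefficients lie in a compact cube. *)
Lemma split_norm_pullback (N : split_norm G) :
  (forall x, exists B, U [set i | N (T i x) <= B]) ->
  exists Q : split_norm F, forall x, N (T i x) @[i --> U] --> Q x.
Proof.
move=> NB; have [Q QP] := seminorm_pullback NB.
have /choice[q qP] (j : 'I_(rank N)) : exists q : seminorm F,
    forall x, part j (T i x) @[i --> U] --> q x.
  apply: seminorm_pullback => x; have [B xB] := NB x; exists B.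
  by apply: filterS xB => i /=; apply: le_trans; exact: part_le.
suff H : [/\ forall j, nonsquare (nsq N) (q j), forall j x, q j x <= Q x &
    forall x0, exists f : 'I_(rank N) -> R, [/\ forall j, 0 <= f j <= 1,
      \sum_j f j * q j x0 = Q x0 & forall x, \sum_j f j * q j x <= Q x]].
  by have [q1 q2 q3] := H; exists (SplitNorm (nsq_gt0 N) (nsq_le1 N) q1 q2 q3).
split.
- move=> j x y.
  have Hmin (f g : I -> R) (a b : R) : f i @[i --> U] --> a -> g i @[i --> U] --> b ->
      Num.min (f i) (g i) @[i --> U] --> Num.min a b.
    move=> fa gb; rewrite minr_absE; under eq_fun do rewrite minr_absE.
    apply: cvgMr_tmp; apply: cvgB; first exact: cvgD.
    by apply: cvg_norm; exact: cvgB.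
  have H : part j (T i x) + part j (T i y) -
      nsq N * Num.min (part j (T i x)) (part j (T i y)) @[i --> U] -->
      q j x + q j y - nsq N * Num.min (q j x) (q j y).
    apply: cvgB; first by apply: cvgD; exact: qP.
    by apply: cvgMl_tmp; apply: Hmin; exact: qP.
  apply: (lim_le (Hmin _ _ _ _ (qP j (x + y)) (qP j (x - y))) H).
  apply: (@filterS3 _ U _ _ _ _ _ _ (TZ (- 1) y) (TD x (- y)) (TD x y)) => i /=; rewrite !scaleN1r => -> -> ->.
  exact: part_nonsquare.
- move=> j x; apply: (lim_le (qP j x) (QP x)).
  by apply: filterE => i; exact: part_le.
- move=> x0; have /choice[f Hf] i := dual N (T i x0).
  have /choice[g gP] (j : 'I_(rank N)) : exists l : R, f i j @[i --> U] --> l.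
    apply: (@ultra_cvg (fun i => f i j) 1); apply: filterE => i /=.
    by have [/(_ j)/andP[f0 f1] _ _] := Hf i; rewrite ger0_norm.
  have sumP x : \sum_j f i j * part j (T i x) @[i --> U] --> \sum_j g j * q j x.
    elim: (index_enum _) => [|j s IH].
      by rewrite big_nil; under eq_fun do rewrite big_nil; exact: cvg_cst.
    rewrite big_cons; under eq_fun do rewrite big_cons.
    by apply: cvgD IH; apply: cvgM; [exact: gP|exact: qP].
  exists g; split.
  + move=> j; apply/andP; split.
      apply: (lim_le (cvg_cst 0) (gP j)); apply: filterE => i /=.
      by have [/(_ j)/andP[]] := Hf i.
    apply: (lim_le (gP j) (cvg_cst (1 : R))); apply: filterE => i /=.
    by have [/(_ j)/andP[]] := Hf i.
  + apply/eqP; rewrite eq_le; apply/andP; split.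
      apply: (lim_le (sumP x0) (QP x0)); apply: filterE => i /=.
      by have [_ -> _] := Hf i.
    apply: (lim_le (QP x0) (sumP x0)); apply: filterE => i /=.
    by have [_ -> _] := Hf i.
  + move=> x; apply: (lim_le (sumP x) (QP x)); apply: filterE => i /=.
    by have [_ _] := Hf i.
Qed.

End Pullback.

(** * The module of bounded sequences *)

Section BoundedSequences.
Variables (R : realType) (E : lmodType R) (N : seminorm E).

Definition bounded_pred : {pred nat -> E} :=
  fun u => `[< exists B, forall n, N (u n) <= B >].

(** Null sequences are not divided out: the ultrapower carries a seminorm only. *)
Record bseq := BSeq { bval :> nat -> E; bvalP : bval \in bounded_pred }.

HB.instance Definition _ := [isSub for bval].
HB.instance Definition _ := [Choice of bseq by <:].

Lemma bounded_submod : submod_closed bounded_pred.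
Proof.
split; first by apply/asboolP; exists 0 => n; rewrite sn0.
move=> a u v /asboolP[B uB] /asboolP[B' vB']; apply/asboolP.
exists (`|a| * B + B') => n; apply: le_trans (snD _ _ _) _.
by rewrite lerD // snZ ler_wpM2l.
Qed.

HB.instance Definition _ := GRing.isSubmodClosed.Build R (nat -> E) bounded_pred bounded_submod.
HB.instance Definition _ := [SubChoice_isSubLmodule of bseq by <:].

Lemma bseqD (u v : bseq) n : (u + v) n = u n + v n. Proof. by []. Qed.

Lemma bseqZ a (u : bseq) n : (a *: u) n = a *: u n. Proof. by []. Qed.

Lemma bseqB (u v : bseq) n : (u - v) n = u n - v n. Proof. by []. Qed.

(** The default, for an unbounded image, is [u] itself. *)
Definition bmap (h : nat -> E -> E) (u : bseq) : bseq :=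
  insubd u (fun n => h n (u n)).

Lemma bmapE h (u : bseq) B : (forall n, N (h n (u n)) <= B) -> forall n, bmap h u n = h n (u n).
Proof.
move=> hB n; rewrite /bmap -[bval _]/(val _) val_insubd ifT //.
by apply/asboolP; exists B.
Qed.

End BoundedSequences.

(** * Mappings asymptotically nonexpansive in the intermediate sense *)
Section Ultrapower.
Variables (R : realType) (E : lmodType R) (N : split_norm E) (U : set_system nat).
Context {FU : UltraFilter U}.
Hypothesis Uoo : forall m, U [set n | (m <= n)%N].

Lemma ultrapower_norm : exists Q : split_norm (bseq N),
  forall u : bseq N, N (u n) @[n --> U] --> Q u.
Proof.
apply: (@split_norm_pullback R nat U FU (bseq N) E (fun n (u : bseq N) => u n)).
  by move=> a u v; apply: filterE.
by move=> u; have /asboolP[B uB] := bvalP u; exists B; apply: filterE.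
Qed.

Variable Q : split_norm (bseq N).
Hypothesis QE : forall u : bseq N, N (u n) @[n --> U] --> Q u.

Lemma ultrapower_le (u : bseq N) (c : R) : (forall e, 0 < e -> U [set n | N (u n) <= c + e]) ->
  Q u <= c.
Proof.
by move=> H; apply/ler_addgt0Pr => e e0; exact: (@cvgr_to_le _ U _ R (fun n => N (u n)) _ _ (@QE u) (H e e0)).
Qed.

Lemma ultrapower_near (u : bseq N) (c : R) : Q u < c -> U [set n | N (u n) < c].
Proof. by move=> uc; exact: (@pseudometric_normed_Zmodule.cvgr_lt _ _ U _ (fun n => N (u n)) _ (@QE u) _ uc). Qed.

Lemma ultrapower_ge (u : bseq N) (c : R) : U [set n | c < N (u n)] -> c <= Q u.
Proof.
move=> H; apply: (@cvgr_to_ge _ U _ R (fun n => N (u n)) _ _ (@QE u)).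
by apply: (@filterS _ U _ _ _ _ H) => n /= /ltW.
Qed.

Variable C : set E.
Hypothesis bC : body N C.

Definition sequences_in := [set u : bseq N | forall n, C (u n)].

(** Completeness is a diagonal argument: the [n]-th entry of the limit is taken from a member
    [u (K (h n))] of a fast Cauchy subsequence. *)
Lemma ultrapower_body : body Q sequences_in.
Proof.
have [[B CB] cC _] := bC.
split.
- exists B => u Cu; apply: ultrapower_le => e e0; apply: filterE => n /=.
  by rewrite (le_trans (CB _ (Cu n))) // lerDl ltW.
- by move=> u v t Cu Cv t0 t1 n; rewrite bseqD !bseqZ; exact: cC.
move=> u Cu cu.
pose eps (i : nat) : R := i.+1%:R^-1.
have eps0 i : 0 < eps i by rewrite invr_gt0.
have /choice[k kP] (i : nat) : exists n0, forall m n, (n0 <= m)%N -> (n0 <= n)%N ->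
    Q (u m - u n) <= eps i / 2 by apply: cu; rewrite divr_gt0.
pose K i := (\sum_(l < i.+1) k l)%N.
have Kk i j : (i <= j)%N -> (k i <= K j)%N.
  by move=> ij; rewrite /K (bigD1 (Ordinal (ij : (i < j.+1)%N))) //= leq_addr.
have close i j : (i <= j)%N -> Q (u (K i) - u (K j)) < eps i.
  move=> ij; apply: le_lt_trans (kP i _ _ (Kk i i (leqnn _)) (Kk i j ij)) _.
  by have := eps0 i; lra.
pose A l := [set n | forall i j, (i <= j)%N -> (j <= l)%N -> N (u (K i) n - u (K j) n) < eps i].
have UA l : U (A l).
  suff : forall j, (j <= l)%N ->
      U [set n | forall i, (i <= j)%N -> N (u (K i) n - u (K j) n) < eps i].
    move=> H; have : U [set n | forall j : 'I_l.+1, forall i, (i <= j)%N ->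
        N (u (K i) n - u (K j) n) < eps i].
      (* Generic sequences of length 1 turn [generic_forall] into finite intersection in [U]. *)
      have := @generic_forall nat U FU 'I_l.+1 1 (fun j s => if s is n :: _ then
        forall i, (i <= j)%N -> N (u (K i) n - u (K j) n) < eps i else False).
      by apply=> j /=; apply: H; rewrite -ltnS.
    apply: filterS => n Hn i j ij jl.
    by have := Hn (Ordinal (jl : (j < l.+1)%N)) i ij.
  move=> j _; have : U [set n | forall i : 'I_j.+1, N (u (K i) n - u (K j) n) < eps i].
    have := @generic_forall nat U FU 'I_j.+1 1 (fun i s => if s is n :: _ then
        N (u (K i) n - u (K j) n) < eps i else False).
    by apply=> i /=; apply: (@ultrapower_near (u (K i) - u (K j))); apply: close; rewrite -ltnS.
  by apply: filterS => n Hn i ij; exact: (Hn (Ordinal (ij : (i < j.+1)%N))).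
(* [h n] is the largest [l <= n] for which the first members of the subsequence are close at entry
   [n]; it exists because [A 0 n] always holds. *)
have /choice[h hP] (n : nat) : exists l, A l n /\ forall j, (j <= n)%N -> A j n -> (j <= l)%N.
  pose P l := (l <= n)%N && `[< A l n >].
  have exP : exists l, P l.
    exists 0%N; rewrite /P /=; apply/asboolP => i j ij; rewrite leqn0 => /eqP j0.
    by move: ij; rewrite j0 leqn0 => /eqP ->; rewrite subrr sn0.
  have ubP l : P l -> (l <= n)%N by case/andP.
  case: (ex_maxnP exP ubP) => l /andP[_ /asboolP Al] lmax.
  by exists l; split => // j jn Aj; apply: lmax; rewrite /P jn; apply/asboolP.
have zB : (fun n => u (K (h n)) n) \in bounded_pred N.
  by apply/asboolP; exists B => n; exact/CB/Cu.
exists (BSeq zB); first by move=> n; exact: Cu.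
have near_z j : Q (u (K j) - BSeq zB) <= eps j.
  apply: ultrapower_le => e e0; apply: filterS2 (UA j) (Uoo j) => n /= Aj jn.
  have [Ah hmax] := hP n; have jh := hmax j jn Aj.
  have := Ah j (h n) jh (leqnn _); have := eps0 j; rewrite /=; lra.
move=> e e0.
have [j Hj] : exists j, eps j <= e / 2.
  exists (Num.truncn (e / 2)^-1); rewrite -[X in _ <= X]invrK lef_pV2 ?posrE ?invr_gt0 ?divr_gt0 //.
  by apply: ltW; exact: truncnS_gt.
exists (K j) => n Kn.
have := kP j n (K j) (leq_trans (Kk j j (leqnn j)) Kn) (Kk j j (leqnn j)).
have := sn_distD Q (u (K j)) (u n) (BSeq zB); have := near_z j.
have := eps0 j; lra.
Qed.

End Ultrapower.

Section IntermediateSense.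
Variables (R : realType) (E : lmodType R) (N : split_norm E).
Variables (C : set E) (T : E -> E).
Hypotheses (bC : body N C) (C0 : C !=set0) (TC : maps_into C T).
Hypothesis Tcont : forall x, C x -> forall e : R, 0 < e -> exists2 d : R, 0 < d &
  forall y, C y -> N (y - x) < d -> N (T y - T x) < e.
Hypothesis Tani : forall e : R, 0 < e -> exists n0 : nat, forall n, (n0 <= n)%N ->
  forall x y, C x -> C y -> N (iter n T x - iter n T y) <= N (x - y) + e.

Let iterC n x : C x -> C (iter n T x).
Proof. by move=> Cx; elim: n => [//|n IH]; exact: TC. Qed.

(* limsup_m N(T^m x - y) <= c *)
Definition orbit_within x y (c : R) := forall e : R, 0 < e ->
  exists n0 : nat, forall m, (n0 <= m)%N -> N (iter m T x - y) <= c + e.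

(* The powers T^phi(n), phi(n) -> oo, form commuting nonexpansive maps of the
   ultrapower; a common fixed point is a sequence of points nearly fixed by all
   large powers of T. *)
Lemma refine_orbit x (c eta : R) : C x -> 0 < eta -> orbit_within x x c ->
  exists y, [/\ C y, orbit_within y y eta & N (x - y) <= 2 * c + eta].
Proof.
move=> Cx eta0 xc.
have [U [FU Usub]] := ultraFilterLemma eventually_filter.
have Uoo m : U [set n | (m <= n)%N] by apply: Usub; exists m.
have [Q QE] := ultrapower_norm N (FU := FU).
have [[B CB] cC _] := bC.
have bQ := ultrapower_body (FU := FU) Uoo QE bC.
(* Restricting to sequences near the tail of the orbit of [x] keeps the refined point near [x]. *)
pose D := [set u : bseq N | (forall n, C (u n)) /\
  forall e : R, 0 < e -> U [set n | orbit_within x (u n) (c + e)]].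
have near_orbit y y' a b : orbit_within x y a -> N (y - y') <= b -> orbit_within x y' (a + b).
  move=> xy yy' e /xy[n0 Hn0]; exists n0 => m /Hn0 Hm.
  have := sn_distD N y (iter m T x) y'; lra.
have weaken y a b : orbit_within x y a -> a <= b -> orbit_within x y b.
  by move=> xy ab e /xy[n0 Hn0]; exists n0 => m /Hn0; lra.
have clD : closed_in Q (@sequences_in R E N C) D.
  split; first by move=> u [].
  move=> u Cu Hu; split => // e e0; have e2 : 0 < e / 2 by rewrite divr_gt0.
  have [v [_ /(_ _ e2) Hv] uv] := Hu _ e2.
  apply: filterS2 Hv (ultrapower_near (FU := FU) QE uv) => n /= xv uvn.
  apply: (weaken _ (c + e / 2 + e / 2)); last lra.
  by apply: near_orbit xv _; rewrite sn_distC ltW.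
have cD : convex_set D.
  move=> u v t [Cu Hu] [Cv Hv] t0 t1; split; first by move=> n; rewrite bseqD !bseqZ; exact: cC.
  move=> e e0; apply: filterS2 (Hu _ e0) (Hv _ e0) => n xu xv d d0.
  have [n0 Hn0] := xu d d0; have [n1 Hn1] := xv d d0.
  exists (maxn n0 n1) => m; rewrite geq_max => /andP[/Hn0 H0 /Hn1 H1].
  rewrite bseqD !bseqZ.
  have -> : iter m T x - (t *: u n + (1 - t) *: v n) =
      t *: (iter m T x - u n) + (1 - t) *: (iter m T x - v n).
    rewrite !scalerBr addrACA -scalerDl (_ : t + (1 - t) = 1); last by lra.
    by rewrite scale1r opprD.
  apply: le_trans (snD _ _ _) _; rewrite !snZ_ge0 //; last by rewrite subr_ge0.
  have := ler_wpM2l t0 H0; have : (1 - t) * N (iter m T x - v n) <= (1 - t) * (c + e + d).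
    by rewrite ler_wpM2l // subr_ge0.
  lra.
have bD : body Q D := closed_in_body bQ clD cD.
pose J := {phi : nat -> nat | forall m, U [set n | (m <= phi n)%N]}.
pose S (phi : J) := @bmap _ _ N (fun n => iter (sval phi n) T).
have SE phi (u : bseq N) : (forall n, C (u n)) -> forall n, S phi u n = iter (sval phi n) T (u n).
  by move=> Cu n; apply: (bmapE (B := B)) => l; exact/CB/iterC.
have SC phi (u : bseq N) : (forall n, C (u n)) -> forall n, C (S phi u n).
  by move=> Cu n; rewrite SE //; exact: iterC.
have SD phi : maps_into D (S phi).
  move=> u [Cu Hu]; split; first exact: SC.
  move=> e e0; have e2 : 0 < e / 2 by rewrite divr_gt0.
  have [n0 Hn0] := Tani e2.
  apply: filterS2 (Hu _ e2) (svalP phi n0) => n /= xu np d /xu[n1 Hn1].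
  (* Writing [T^m x] as [T^phi(n)] applied to a late point of the orbit compares it with
     [T^phi(n) (u n)]. *)
  exists (n1 + sval phi n)%N => m nm; rewrite SE //.
  have pm : (sval phi n <= m)%N by rewrite (leq_trans _ nm) // leq_addl.
  rewrite -(subnKC pm) iterD.
  have := Hn0 _ np _ _ (iterC (m - sval phi n) Cx) (Cu n).
  have := Hn1 (m - sval phi n)%N; rewrite leq_subRL // addnC => /(_ nm); lra.
have Sne phi : nonexpansive Q D (S phi).
  move=> u v [Cu _] [Cv _]; apply: (ultrapower_le (FU := FU) QE) => e e0.
  have e2 : 0 < e / 2 by rewrite divr_gt0.
  have [n0 Hn0] := Tani e2.
  have uv : Q (u - v) < Q (u - v) + e / 2 by rewrite ltrDl.
  apply: filterS2 (ultrapower_near (FU := FU) QE uv) (svalP phi n0) => n uvn np.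
  suff : N ((S phi u - S phi v) n) <= Q (u - v) + e by [].
  rewrite bseqB !SE //.
  have {}uvn : N (u n - v n) < Q (u - v) + e / 2 := uvn.
  have := Hn0 _ np _ _ (Cu n) (Cv n); lra.
have Scomm i j u : D u -> S i (S j u) = S j (S i u).
  move=> [Cu _]; apply: val_inj; apply/funext => n /=.
  rewrite !SE //; [|exact: SC|exact: SC].
  by rewrite -!iterD addnC.
have [|u [Cu Hu] uS] := commuting_common_fixed_point bD SD Sne Scomm.
  have xB : (fun=> x) \in bounded_pred N by apply/asboolP; exists B => _; exact: CB.
  exists (BSeq xB); split => // e e0; apply: filterE => n /=.
  by apply: (weaken _ _ _ xc); rewrite lerDl ltW.
(* If this fails, choosing violating exponents as [phi n] gives a member of the family that does not
   fix [u]. *)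
have almost (d : R) : 0 < d -> U [set n | forall m, (n <= m)%N -> N (iter m T (u n) - u n) <= d].
  move=> d0; have [//|nU] := in_ultra_setVsetC
    [set n | forall m, (n <= m)%N -> N (iter m T (u n) - u n) <= d] FU.
  have /choice[phi phiP] (n : nat) : exists m, (n <= m)%N /\
      ((~ forall m, (n <= m)%N -> N (iter m T (u n) - u n) <= d) -> d < N (iter m T (u n) - u n)).
    have [H|H] := pselect (forall m, (n <= m)%N -> N (iter m T (u n) - u n) <= d).
      by exists n.
    have [m Hm] := (existsNP _).2 H.
    by move: Hm; rewrite not_implyE => -[nm /negP]; exists m; split => // _; rewrite ltNge.
  have phiJ m : U [set n | (m <= phi n)%N].
    by apply: filterS (Uoo m) => n /= mn; case: (phiP n) => + _; exact: leq_trans.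
  have := ultrapower_ge (FU := FU) QE (u := S (exist _ phi phiJ) u - u) (c := d).
  rewrite uS => H; have : d <= 0; last by rewrite leNgt d0.
  apply: H; apply: filterS nU => n nH.
  suff : d < N ((S (exist _ phi phiJ) u - u) n) by [].
  rewrite bseqB SE //=.
  by case: (phiP n) => _; apply.
have e4 : 0 < eta / 4 by rewrite divr_gt0.
have [n [Hn xu]] := filter_ex (filterI (almost _ e4) (Hu _ e4)).
exists (u n); split => //.
  by move=> e e0; exists n => m /Hn; lra.
have [n0 Hn0] := xu _ e4; have [n1 Hn1] := xc _ e4.
have := Hn0 _ (leq_maxl n0 n1); have := Hn1 _ (leq_maxr n0 n1).
set v := iter _ T x => H1 H2.
by have := sn_distD N v x (u n); rewrite (sn_distC N x v); lra.
Qed.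

(** Refining with tolerances [2 ^- k] gives a Cauchy sequence whose limit [z] satisfies
    [T^n z -> z]; continuity of [T] at [z] then gives the fixed point. *)
Lemma ani_fixed_point : exists2 x, C x & N (T x - x) = 0.
Proof.
have [[B CB] _ pC] := bC; have [x0 Cx0] := C0.
pose q (k : nat) : R := 2^-1 ^+ k.
have q0 k : 0 < q k by rewrite exprn_gt0 // invr_gt0.
have qS k : q k.+1 = q k / 2 by rewrite /q exprS mulrC.
have [y0 [Cy0 y00 _]] : exists y, [/\ C y, orbit_within y y 1 & N (x0 - y) <= 2 * (2 * B) + 1].
  apply: refine_orbit => // e e0; exists 0%N => m _.
  apply: le_trans (snB _ _ _) _; have := CB _ Cx0; have := CB _ (iterC m Cx0); lra.
have /choice[step stepP] (ky : nat * E) : exists y', C ky.2 -> orbit_within ky.2 ky.2 (q ky.1) ->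
    [/\ C y', orbit_within y' y' (q ky.1.+1) & N (ky.2 - y') <= 2 * q ky.1 + q ky.1.+1].
  have [[Cy yq]|H] := pselect (C ky.2 /\ orbit_within ky.2 ky.2 (q ky.1)).
    by have [y' Hy'] := refine_orbit Cy (q0 ky.1.+1) yq; exists y'.
  by exists 0 => Cy yq; case: H.
pose y := fix y k := if k is k'.+1 then step (k', y k') else y0.
have yP k : C (y k) /\ orbit_within (y k) (y k) (q k).
  elim: k => [|k [Cy yq]]; first by rewrite /q expr0.
  by have [] := stepP (k, y k) Cy yq.
have ystep k : N (y k - y k.+1) <= 3 * q k.
  have [Cy yq] := yP k; have [_ _] := stepP (k, y k) Cy yq.
  by rewrite /= qS; have := q0 k; lra.
(* The step bounds telescope: [3 * q k = 6 * q k - 6 * q k.+1]. *)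
have ydist k m : N (y k - y (k + m)%N) <= 6 * q k - 6 * q (k + m)%N.
  elim: m => [|m IH]; first by rewrite addn0 !subrr sn0.
  have := sn_distD N (y (k + m)%N) (y k) (y (k + m).+1); have := ystep (k + m)%N.
  rewrite addnS qS; lra.
have ydist' k m : (k <= m)%N -> N (y k - y m) <= 6 * q k.
  by move=> km; have := ydist k (m - k)%N; rewrite subnKC //; have := q0 m; lra.
have qlim (e : R) : 0 < e -> exists k, q k < e.
  move=> e0; exists (Num.truncn e^-1).+1.
  have -> : q (Num.truncn e^-1).+1 = (2 ^+ (Num.truncn e^-1).+1)^-1 by rewrite /q exprVn.
  rewrite -[X in _ < X]invrK ltf_pV2 ?posrE ?invr_gt0 ?exprn_gt0 //.
  apply: lt_le_trans (truncnS_gt _) _.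
  by rewrite -natrX ler_nat ltnW // ltn_expl.
have [e e0|z Cz yz] := pC y (fun k => (yP k).1).
  have [k Hk] := qlim (e / 12) ltac:(by rewrite divr_gt0).
  exists k => m n km kn.
  have := sn_distD N (y k) (y m) (y n); rewrite (sn_distC N (y m) (y k)).
  have := ydist' _ _ km; have := ydist' _ _ kn; lra.
have Tz (e : R) : 0 < e -> exists n0 : nat, forall n, (n0 <= n)%N -> N (iter n T z - z) <= e.
  move=> e0; have e8 : 0 < e / 8 by rewrite divr_gt0.
  have [k Hk] := qlim _ e8; have [n0 Hn0] := yz _ e8.
  pose l := maxn k n0.
  have qk : q l <= q k.
    rewrite /l; have [m ->] : exists m, maxn k n0 = (k + m)%N.
      by exists (maxn k n0 - k)%N; rewrite subnKC // leq_maxl.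
    by rewrite /q exprD; apply: ler_piMr; [exact: ltW (q0 k)|apply: exprn_ile1; lra].
  have zl := Hn0 l (leq_maxr _ _).
  have [n1 Hn1] := Tani e8; have [Cy /(_ _ e8)[n2 Hn2]] := yP l.
  exists (maxn n1 n2) => n; rewrite geq_max => /andP[/Hn1/(_ _ _ Cz Cy) H1 /Hn2 H2].
  have := sn_distD N (iter n T (y l)) (iter n T z) z.
  have := sn_distD N (y l) (iter n T (y l)) z; rewrite (sn_distC N z) in H1.
  lra.
exists z => //; apply/eqP; rewrite eq_le sn_ge0 andbT; apply/ler_addgt0Pr => e e0.
have e2 : 0 < e / 2 by rewrite divr_gt0.
have [d d0 Hd] := Tcont Cz e2.
have d2 : 0 < d / 2 by rewrite divr_gt0.
have [n0 Hn0] := Tz _ e2; have [n1 Hn1] := Tz _ d2.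
pose n := maxn n0 n1.
have /Hd : C (iter n T z) by exact: iterC.
have := Hn1 n (leq_maxr _ _) => Hn /(_ _) HT.
have {}HT : N (T (iter n T z) - T z) < e / 2 by apply: HT; lra.
have := Hn0 n.+1 (leq_trans (leq_maxl _ _) (leqnSn _)).
have := sn_distD N (iter n.+1 T z) (T z) z; rewrite /= (sn_distC N (T z) (T _)); lra.
Qed.

End IntermediateSense.

(** * Direct sums *)
Section Sublinear.
Variables (R : realType) (F : lmodType R).
Implicit Types (q : F -> R) (v x y : F).

Definition sublinear q := (forall x y, q (x + y) <= q x + q y) /\
  (forall (a : R) x, 0 <= a -> q (a *: x) <= a * q x).

Lemma sublinear0 q : sublinear q -> q 0 = 0.
Proof.
move=> [qD qZ]; apply/eqP; rewrite eq_le; apply/andP; split.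
  by have := qZ 0 0 (lexx 0); rewrite scale0r mul0r.
by have := qD 0 0; rewrite addr0; lra.
Qed.

Lemma sublinear_ge q x : sublinear q -> - q (- x) <= q x.
Proof. by move=> sq; have := sq.1 x (- x); rewrite subrr sublinear0 //; lra. Qed.

(* The infimum of q (x + t v) - t q v over t >= 0 is the largest sublinear
   minorant of q that is linear along v and agrees with q at v. *)
Lemma sublinear_step q v : sublinear q -> exists q',
  [/\ sublinear q', forall x, q' x <= q x & q' (- v) <= - q v].
Proof.
move=> sq; have [qD qZ] := sq.
pose W x := [set q (x + t *: v) - t * q v | t in [set t : R | 0 <= t]].
have Winf x : has_inf (W x).
  split; first by exists (q (x + 0 *: v) - 0 * q v), 0 => //=.
  exists (- q (- x)) => _ [t /= t0 <-].
  have := qZ t v t0; have := qD (x + t *: v) (- x).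
  have : t * q v <= q (t *: v).
    have [->|tn0] := eqVneq t 0; first by rewrite scale0r mul0r sublinear0.
    have tp : 0 < t by rewrite lt_def tn0.
    have := qZ t^-1 (t *: v); rewrite scalerA mulVf // scale1r invr_ge0 t0 => /(_ isT).
    by rewrite -ler_pdivlMl.
  by rewrite addrAC subrr add0r; lra.
have Wle x t : 0 <= t -> inf (W x) <= q (x + t *: v) - t * q v.
  by move=> t0; apply: ge_inf; [exact: (Winf x).2|exists t].
exists (fun x => inf (W x)); split.
- split=> [x y|a x a0].
    apply/ler_addgt0Pr => e e0; have e2 : 0 < e / 2 by rewrite divr_gt0.
    have [_ [t /= t0 <-] xt] := inf_adherent e2 (Winf x).
    have [_ [s /= s0 <-] ys] := inf_adherent e2 (Winf y).
    have := Wle (x + y) (t + s) (addr_ge0 t0 s0); rewrite scalerDl addrACA.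
    by have := qD (x + t *: v) (y + s *: v); lra.
  have [->|an0] := eqVneq a 0.
    have := Wle (0 *: x) 0 (lexx 0).
    by rewrite !scale0r addr0 sublinear0 // !mul0r subr0.
  have ap : 0 < a by rewrite lt_def an0.
  rewrite -ler_pdivrMl //; apply: lb_le_inf; first exact: (Winf x).1.
  move=> _ [t /= t0 <-]; rewrite ler_pdivrMl //.
  have := Wle (a *: x) (a * t) (mulr_ge0 a0 t0); rewrite -scalerA -scalerDr.
  by have := qZ a (x + t *: v) a0; lra.
- by move=> x; have := Wle x 0 (lexx 0); rewrite scale0r addr0 mul0r subr0.
- have := Wle (- v) 1 ler01; rewrite scale1r addNr sublinear0 //; lra.
Qed.

(** A finite Hahn-Banach theorem. Linearity along a vector, once obtained, survives in every smaller
    sublinear functional, so the vectors are treated one by one. *)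
Lemma sublinear_minorant q v (s : seq F) : sublinear q -> exists q',
  [/\ sublinear q', forall x, q' x <= q x, q' v = q v &
      forall u, u \in s -> q' (- u) = - q' u].
Proof.
move=> sq; suff [q' [sq' q'q q'v q's]] : exists q', [/\ sublinear q',
    forall x, q' x <= q x, q' (- v) <= - q v & forall u, u \in s -> q' (- u) <= - q' u].
  exists q'; split => //.
    by have := sublinear_ge v sq'; have := q'q v; lra.
  by move=> u us; have := q's u us; have := sublinear_ge u sq'; lra.
elim: s => [|u s [q1 [sq1 q1q q1v q1s]]].
  by have [q' [sq' q'q q'v]] := sublinear_step v sq; exists q'.
have [q' [sq' q'q q'u]] := sublinear_step u sq1.
exists q'; split => // [x|| w].
- exact: le_trans (q'q x) (q1q x).
- exact: le_trans (q'q _) q1v.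
rewrite inE => /orP[/eqP ->|ws]; first by have := q'q u; lra.
by have := q'q (- w); have := q'q w; have := q1s w ws; lra.
Qed.

End Sublinear.

(** * Norming functionals of absolute norms *)

Section AbsoluteNorm.
Variables (R : realType) (r : nat) (psi : ('I_r -> R) -> R).
Hypotheses (npsi : is_norm_Rn psi) (apsi : absolute_Rn psi) (n1psi : normalized_Rn psi).

Lemma absolute_dual (x0 : 'I_r -> R) : (forall j, 0 <= x0 j) -> exists f : 'I_r -> R,
  [/\ forall j, 0 <= f j <= 1, \sum_j f j * x0 j = psi x0 &
      forall x : 'I_r -> R, (forall j, 0 <= x j) -> \sum_j f j * x j <= psi x].
Proof.
move=> x00; have [_ pZ pD] := npsi.
have sp : sublinear (psi : ('I_r -> R : lmodType R) -> R).
  by split=> [x y|a x a0]; [exact: pD|rewrite -{2}(ger0_norm a0) -pZ].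
pose e (i : 'I_r) : 'I_r -> R := fun j => (j == i)%:R.
have [q [[qD qZ] qpsi qx0 qe]] := sublinear_minorant x0 [seq e i | i <- enum 'I_r] sp.
have {}qe i : q (- e i) = - q (e i) by apply/qe/map_f; rewrite mem_enum.
have qZe (a : R) i : q (a *: e i) <= a * q (e i).
  have [a0|a0] := leP 0 a; first exact: qZ.
  have := qZ (- a) (- e i); rewrite scaleNr scalerN opprK qe mulrNN; apply.
  by rewrite oppr_ge0 ltW.
have scE (a : R) (g : 'I_r -> R) i : (a *: g) i = a * g i by [].
have qE (x : 'I_r -> R) : q x = \sum_j q (e j) * x j.
  have xE : x = \sum_j x j *: e j.
    apply/funext => i; rewrite fct_sumE (bigD1 i) //= big1 => [|j ji].
      by rewrite scE /e eqxx mulr1 addr0.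
    by rewrite scE /e eq_sym (negbTE ji) mulr0.
  have le (y : 'I_r -> R) : q (\sum_j y j *: e j) <= \sum_j q (e j) * y j.
    elim/big_rec2 : _ => [|j a b _ H]; first by rewrite (sublinear0 (conj qD qZ)).
    by apply: le_trans (qD _ _) _; rewrite lerD // mulrC.
  apply/eqP; rewrite eq_le {1}xE le /=.
  have := le (- x); have -> : \sum_j (- x) j *: e j = - x.
    by rewrite {2}xE -sumrN; apply: eq_bigr => j _; rewrite -scaleNr.
  have := sublinear_ge x (conj qD qZ).
  have -> : \sum_j q (e j) * (- x) j = - \sum_j q (e j) * x j.
    by rewrite -sumrN; apply: eq_bigr => j _; rewrite -mulrN.
  lra.
pose f j := `|q (e j)|.
have fle (x : 'I_r -> R) : (forall j, 0 <= x j) -> \sum_j f j * x j <= psi x.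
  (* Coefficients may be replaced by absolute values: the signs move to [x], where the absolute norm
     ignores them. *)
  move=> x0'; pose y j := (-1) ^+ (q (e j) < 0)%R * x j.
  have -> : \sum_j f j * x j = q y.
    rewrite qE; apply: eq_bigr => j _; rewrite /f /y mulrA; congr (_ * _).
    by rewrite normrEsign mulrC.
  apply: le_trans (qpsi y) _; rewrite apsi [leRHS]apsi le_eqVlt; apply/orP; left; apply/eqP.
  by congr psi; apply/funext => j; rewrite /y normrM normr_sign mul1r.
have esum j (g : 'I_r -> R) : \sum_i g i * e j i = g j.
  rewrite (bigD1 j) //= big1 => [|i ij]; first by rewrite /e eqxx mulr1 addr0.
  by rewrite /e (negbTE ij) mulr0.
exists f; split => //.
- move=> j; rewrite normr_ge0 /=.
  have := fle (e j); rewrite esum n1psi; apply => i; exact: ler0n.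
- apply/eqP; rewrite eq_le fle //= -qx0 qE; apply: ler_sum => j _.
  by rewrite ler_wpM2r // ler_norm.
Qed.

End AbsoluteNorm.

(** Let [x] be the longer vector. Split off from it a multiple of norm [|x| - |y|]; what remains has
    the norm of [y], and the definition applies to the normalized directions. All [k <= d] are
    allowed so that finitely many spaces can share one constant. *)
Lemma uniformly_nonsquareP (R : realType) (X : normedModType R) : uniformly_nonsquare X ->
  exists2 d : R, 0 < d & forall k, k <= d -> nonsquare k (fun x : X => `|x|).
Proof.
move=> [d d0 Hd]; exists d => // k kd.
have key (x y : X) : `|y| <= `|x| ->
    Num.min `|x + y| `|x - y| <= `|x| + `|y| - d * `|y|.
  move=> yx; have [->|y0] := eqVneq y 0.
    by rewrite addr0 subr0 normr0 mulr0 subr0 addr0 ge_min lexx.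
  have yp : 0 < `|y| by rewrite normr_gt0.
  have xp : 0 < `|x| by exact: lt_le_trans yx.
  pose u := `|x|^-1 *: x; pose v := `|y|^-1 *: y.
  have u1 : `|u| = 1 by rewrite normrZ ger0_norm ?invr_ge0 // mulVf ?gt_eqF.
  have v1 : `|v| = 1 by rewrite normrZ ger0_norm ?invr_ge0 // mulVf ?gt_eqF.
  have xE : x = (`|x| - `|y|) *: u + `|y| *: u.
    by rewrite -scalerDl subrK scalerA mulfV ?gt_eqF // scale1r.
  have yE : y = `|y| *: v by rewrite scalerA mulfV ?gt_eqF // scale1r.
  have uu : `|(`|x| - `|y|) *: u| = `|x| - `|y|.
    by rewrite normrZ u1 mulr1 ger0_norm // subr_ge0.
  have Hp : `|x + y| <= `|x| - `|y| + `|y| * `|u + v|.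
    rewrite {1}xE {3}yE -addrA -scalerDr (le_trans (ler_normD _ _)) // uu lerD2l.
    by rewrite normrZ normr_id.
  have Hm : `|x - y| <= `|x| - `|y| + `|y| * `|u - v|.
    rewrite {1}xE {3}yE -addrA -scalerBr (le_trans (ler_normD _ _)) // uu lerD2l.
    by rewrite normrZ normr_id.
  have := Hd u v u1 v1; rewrite ge_min => /orP[H|H]; rewrite ge_min; apply/orP; [left|right].
    by apply: le_trans Hp _; have := ler_wpM2l (ltW yp) H; lra.
  by apply: le_trans Hm _; have := ler_wpM2l (ltW yp) H; lra.
move=> x y /=; have [xy|yx] := leP `|x| `|y|.
  have := key y x xy; rewrite (addrC y) distrC.
  have : k * `|x| <= d * `|x| by rewrite ler_wpM2r.
  lra.
have := key x y (ltW yx).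
have : k * `|y| <= d * `|y| by rewrite ler_wpM2r.
lra.
Qed.

Lemma complete_seq (R : realType) (X : completeNormedModType R) (u : nat -> X) :
  (forall e : R, 0 < e -> exists n0 : nat, forall m n, (n0 <= m)%N -> (n0 <= n)%N ->
     `|u m - u n| <= e) ->
  exists z : X, forall e : R, 0 < e -> exists n0 : nat, forall n, (n0 <= n)%N -> `|u n - z| <= e.
Proof.
move=> cu; have : cvg (u @ \oo).
  apply: cauchy_cvg; apply: cauchy_exP => e e0.
  have [n0 Hn0] := cu (e / 2) ltac:(by rewrite divr_gt0).
  exists (u n0); exists n0 => // n /= n0n; rewrite -ball_normE /=.
  by apply: le_lt_trans (Hn0 _ _ (leqnn _) n0n) _; lra.
move=> /cvg_ex[z uz]; exists z => e e0.
have [n0 _ Hn0] := (pseudometric_normed_Zmodule.cvgrPdist_lt _ _).1 uz e e0.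
by exists n0 => n /Hn0 /= H; rewrite distrC ltW.
Qed.

Section FppOfSplitNorm.
Variables (R : realType) (E : lmodType R) (N : split_norm E) (nu : E -> R).
Hypotheses (nuE : nu =1 N) (N0 : forall x, N x = 0 -> x = 0).
Hypothesis Ncomplete : complete_set N setT.

Lemma fpp_of_split_norm : ns_fpp_ani (@NSpace R E (fun x y => x + y) (fun a x => a *: x) nu).
Proof.
move=> C T C0 [B CB] clC cC [TC [Tcont Tani]].
have dE x y : nu (x + (-1) *: y) = N (x - y) by rewrite nuE scaleN1r.
have bC : body N C.
  split; first by exists B => x /CB; rewrite /= nuE.
    exact: cC.
  move=> u Cu cu; have [z _ uz] := Ncomplete (fun n => I) cu.
  exists z => //; apply: (clC u z Cu) => e e0.
  have [n0 Hn0] := uz (e / 2) ltac:(by rewrite divr_gt0).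
  exists n0 => n /Hn0 H; rewrite /ns_dist /ns_sub /= dE; lra.
have [||x Cx Tx] := ani_fixed_point bC C0 TC.
- move=> x Cx e e0; have [d d0 Hd] := Tcont x Cx e e0.
  exists d => // y Cy yx; have := Hd y Cy; rewrite /ns_dist /ns_sub /= !dE; exact.
- move=> e e0; have [n0 Hn0] := Tani e e0; exists n0 => n nn x y Cx Cy.
  have := Hn0 n nn x y Cx Cy; rewrite /ns_dist /ns_sub /= !dE; lra.
by exists x => //; apply/eqP; rewrite -subr_eq0; apply/eqP/N0.
Qed.

End FppOfSplitNorm.

(** * The direct sum and the spaces finitely representable in it *)

Section DirectSum.
Variables (R : realType) (r : nat) (X : 'I_r -> completeNormedModType R).

(** The carrier of [psi_sum] under a name that can carry a module structure, with the same
    operations. *)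
Definition dsum := forall i, X i.

HB.instance Definition _ := gen_eqMixin dsum.
HB.instance Definition _ := gen_choiceMixin dsum.

Let ext (x y : dsum) : (forall i, x i = y i) -> x = y.
Proof. exact: functional_extensionality_dep. Qed.

Let addA : associative (fun (x y : dsum) i => x i + y i).
Proof. by move=> x y z; apply: ext => i; rewrite addrA. Qed.

Let addC : commutative (fun (x y : dsum) i => x i + y i).
Proof. by move=> x y; apply: ext => i; rewrite addrC. Qed.

Let add0 : left_id ((fun i => 0) : dsum) (fun (x y : dsum) i => x i + y i).
Proof. by move=> x; apply: ext => i; rewrite add0r. Qed.

Let addN : left_inverse ((fun i => 0) : dsum) (fun x i => - x i) (fun (x y : dsum) i => x i + y i).
Proof. by move=> x; apply: ext => i; rewrite addNr. Qed.

HB.instance Definition _ := GRing.isZmodule.Build dsum addA addC add0 addN.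

Let scaleA (a b : R) (x : dsum) : (fun i => a *: (b *: x i)) = (fun i => (a * b) *: x i) :> dsum.
Proof. by apply: ext => i; rewrite scalerA. Qed.

Let scale1 (x : dsum) : (fun i => 1 *: x i) = x :> dsum.
Proof. by apply: ext => i; rewrite scale1r. Qed.

Let scaleDr (a : R) (x y : dsum) :
  (fun i => a *: (x i + y i)) = (fun i => a *: x i + a *: y i) :> dsum.
Proof. by apply: ext => i; rewrite scalerDr. Qed.

Let scaleDl (x : dsum) (a b : R) :
  (fun i => (a + b) *: x i) = (fun i => a *: x i + b *: x i) :> dsum.
Proof. by apply: ext => i; rewrite scalerDl. Qed.

HB.instance Definition _ := GRing.Zmodule_isLmodule.Build R dsum
  (scale := fun a (x : dsum) => (fun i => a *: x i) : dsum) scaleA scale1 scaleDr scaleDl.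

Variable psi : ('I_r -> R) -> R.
Hypotheses (Xns : forall i, uniformly_nonsquare (X i)).
Hypotheses (npsi : is_norm_Rn psi) (apsi : absolute_Rn psi) (n1psi : normalized_Rn psi).

Lemma dsum_split_norm : exists N : split_norm dsum,
  [/\ forall x, N x = psi (fun i => `|x i|), forall x i, `|x i| <= N x &
      forall x, N x <= \sum_i `|x i|].
Proof.
have [p0 pZ pD] := npsi.
have dualP (x0 : dsum) : exists f : 'I_r -> R, [/\ forall j, 0 <= f j <= 1,
    \sum_j f j * `|x0 j| = psi (fun i => `|x0 i|) &
    forall x : dsum, \sum_j f j * `|x j| <= psi (fun i => `|x i|)].
  have [|f [f01 fx0 fx]] := absolute_dual npsi apsi n1psi (x0 := fun j => `|x0 j|).
    by move=> j; exact: normr_ge0.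
  by exists f; split => // x; apply: fx => j; exact: normr_ge0.
have mono (x y : 'I_r -> R) : (forall j, 0 <= x j) -> (forall j, x j <= y j) -> psi x <= psi y.
  move=> x0 xy; have [f [f01 <- fx]] := absolute_dual npsi apsi n1psi x0.
  apply: le_trans (fx y _); last by move=> j; exact: le_trans (xy j).
  by apply: ler_sum => j _; rewrite ler_wpM2l //; case/andP: (f01 j).
have nD (x y : dsum) : psi (fun i => `|(x + y) i|) <= psi (fun i => `|x i|) + psi (fun i => `|y i|).
  apply: le_trans (pD _ _); apply: mono => j; first exact: normr_ge0.
  exact: ler_normD.
have nZ a (x : dsum) : psi (fun i => `|(a *: x) i|) = `|a| * psi (fun i => `|x i|).
  rewrite -[in RHS](normr_id a) -pZ; congr psi; apply/funext => i; exact: normrZ.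
pose N : seminorm dsum := Seminorm nD nZ.
have cD j (x y : dsum) : `|(x + y) j| <= `|x j| + `|y j| by exact: ler_normD.
have cZ j a (x : dsum) : `|(a *: x) j| = `|a| * `|x j| by exact: normrZ.
pose c j : seminorm dsum := Seminorm (cD j) (cZ j).
(* A functional norming the [j]-th unit vector has [j]-th coefficient 1. *)
have cN j (x : dsum) : c j x <= N x.
  have e0 i : 0 <= (i == j)%:R :> R by exact: ler0n.
  have [f [f01 fe fx]] := absolute_dual npsi apsi n1psi e0.
  have fj : f j = 1.
    rewrite -(n1psi j) -fe (bigD1 j) //= eqxx mulr1 big1 ?addr0 // => i /negbTE ->.
    by rewrite mulr0.
  have := fx (fun i => `|x i|) (fun i => normr_ge0 _).
  rewrite (bigD1 j) //= fj mul1r; apply: le_trans; rewrite lerDl.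
  by apply: sumr_ge0 => i _; rewrite mulr_ge0 //; case/andP: (f01 i).
have /choice[d dP] (i : 'I_r) : exists d, 0 < d /\
    forall k, k <= d -> nonsquare k (fun x : X i => `|x|).
  by have [d ? ?] := uniformly_nonsquareP (Xns i); exists d.
pose k := \big[Num.min/1]_i d i.
have k0 : 0 < k.
  by apply: (big_ind (fun t : R => 0 < t)) => [|a b a0 b0|i _] //; [rewrite lt_min a0|case: (dP i)].
have k1 : k <= 1 by exact: bigmin_le_id.
have kns j : nonsquare k (c j).
  move=> x y; case: (dP j) => _ /(_ k (bigmin_le_cond _ _ isT)) /(_ (x j) (y j)).
  exact.
exists (SplitNorm k0 k1 kns cN dualP); split => // [x i|x /=]; first exact: cN.
have [f [f01 <- _]] := dualP x; apply: ler_sum => j _.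
by rewrite ler_piMl //; case/andP: (f01 j).
Qed.

Variables (N : split_norm dsum).
Hypotheses (NE : forall x, N x = psi (fun i => `|x i|)) (Nge : forall x i, `|x i| <= N x).
Hypothesis Nle : forall x, N x <= \sum_i `|x i|.

Lemma dsum_complete : complete_set N setT.
Proof.
move=> u _ cu.
have H i : exists z : X i, forall e : R, 0 < e ->
    exists n0 : nat, forall n, (n0 <= n)%N -> `|u n i - z| <= e.
  apply: complete_seq => e /cu[n0 Hn0]; exists n0 => m n mn nn.
  exact: le_trans (Nge (u m - u n) i) (Hn0 m n mn nn).
pose z : dsum := fun i => sval (cid (H i)); have zP i := svalP (cid (H i)).
exists z => // e e0.
have re0 : 0 < e / r.+1%:R by rewrite divr_gt0.
have /choice[n0 Hn0] (i : 'I_r) := zP i _ re0.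
exists (\sum_i n0 i)%N => n nn; apply: le_trans (Nle _) _.
apply: (@le_trans _ _ (\sum_(i < r) e / r.+1%:R)).
  apply: ler_sum => i _; apply: Hn0; apply: leq_trans nn.
  by rewrite (bigD1 i) //= leq_addr.
rewrite sumr_const card_ord -[_ *+ _]mulr_natr -mulrA ler_piMr ?(ltW e0) //.
by rewrite ler_pdivrMl // mulr1 ler_nat leqnSn.
Qed.

Lemma dsum_fpp : ns_fpp_ani (psi_sum (fun i => X i : normedModType R) psi).
Proof.
apply: (@fpp_of_split_norm R dsum N (fun x => psi (fun i => `|x i|))).
- by move=> x; rewrite NE.
- move=> x Nx0; apply: ext => i; apply/eqP; rewrite -normr_eq0 eq_le normr_ge0 andbT.
  by rewrite -[leRHS]Nx0; exact: Nge.
- exact: dsum_complete.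
Qed.

(** Along an ultrafilter on finite lists of vectors and precisions, the norm of [Y] is the limit of
    the norms of almost isometric images, so [split_norm_pullback] makes it a split norm. *)
Lemma dsum_super_fpp : ns_super_fpp_ani (psi_sum (fun i => X i : normedModType R) psi).
Proof.
move=> Y fr.
have /choice[Tcd TP] (lm : seq Y * nat) : exists q : (Y -> dsum) * R * R,
    [/\ forall (a : R) z w, z \in lm.1 -> w \in lm.1 -> q.1.1 (a *: z + w) = a *: q.1.1 z + q.1.1 w,
      0 < q.1.2, 0 < q.2, q.1.2 * q.2 <= 1 + lm.2.+1%:R^-1 &
      forall z, z \in lm.1 -> N (q.1.1 z) <= q.1.2 * `|z| /\ `|z| <= q.2 * N (q.1.1 z)].
  case: lm => l m; have m0 : 0 < m.+1%:R^-1 :> R by rewrite invr_gt0.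
  have [T [c [d [Tlin c0 d0 cd Tn]]]] := fr (size l) (fun i => nth 0 l i) _ m0.
  have inspan z : z \in l -> span_of (fun i : 'I_(size l) => nth 0 l i) z.
    move=> zl; have il : (index z l < size l)%N by rewrite index_mem.
    exists (fun i => (i == Ordinal il)%:R); rewrite (bigD1 (Ordinal il)) //= big1 => [|i /negbTE ->].
      by rewrite eqxx scale1r addr0 nth_index.
    by rewrite scale0r.
  exists (T, c, d); split => //= [a z w zl wl|z zl].
    exact: (Tlin a z w (inspan z zl) (inspan w wl)).
  by rewrite !NE; exact: (Tn z (inspan z zl)).
pose Bs (lm : seq Y * nat) := [set lm' : seq Y * nat | {subset lm.1 <= lm'.1} /\ (lm.2 <= lm'.2)%N].
have FF : ProperFilter (filter_from setT Bs).
  apply: filter_from_proper; last by move=> lm _; exists lm; split.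
  apply: filter_fromT_filter; first by exists ([::], 0%N).
  move=> [l m] [l' m']; exists (l ++ l', maxn m m') => -[l'' m''] /= [ll].
  rewrite geq_max => /andP[mm mm']; split; split => // z zl; apply: ll.
    by rewrite mem_cat zl.
  by rewrite mem_cat zl orbT.
have [U [UU FU]] := ultraFilterLemma FF.
have Uin (z : Y) : U [set lm : seq Y * nat | z \in lm.1].
  by apply: FU; exists ([:: z], 0%N) => // lm [/(_ z)]; rewrite inE eqxx => /(_ isT).
have Um m : U [set lm : seq Y * nat | (m <= lm.2)%N] by apply: FU; exists ([::], m) => // lm [].
(* After this rescaling [N (T lm z) <= |z| <= (1 + 1 / (m + 1)) * N (T lm z)] for [z] in the
   list. *)
pose T lm (z : Y) := (Tcd lm).1.2^-1 *: (Tcd lm).1.1 z.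
have TN z : U [set lm | N (T lm z) <= `|z|].
  apply: filterS (Uin z) => lm /= zl; have [_ c0 d0 _ /(_ z zl)[H _]] := TP lm.
  by rewrite snZ_ge0 ?invr_ge0 ?(ltW c0) // ler_pdivrMl.
have [||Q QE] := @split_norm_pullback R _ U UU Y dsum T _ N.
- move=> a z w; apply: filterS2 (Uin z) (Uin w) => lm /= zl wl.
  have [Tlin _ _ _ _] := TP lm.
  by rewrite /T Tlin // scalerDr !scalerA mulrC.
- by move=> z; exists `|z|.
have nQ z : `|z| = Q z.
  apply/eqP; rewrite eq_le; apply/andP; split; last first.
    exact: (@cvgr_to_le _ U _ R (fun lm => N (T lm z)) _ _ (@QE z) (TN z)).
  apply/ler_addgt0Pr => e e0; rewrite -lerBlDr.
  apply: (@cvgr_to_ge _ U _ R (fun lm => N (T lm z)) _ _ (@QE z)).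
  pose m := Num.truncn (`|z| / e).
  apply: (@filterS3 _ U _ _ _ _ _ _ (Uin z) (Um m) (TN z)) => -[l m'] /= zl mm Tz.
  have [_ c0 d0 cd /(_ z zl)[_ H]] := TP (l, m'); rewrite /= in c0 d0 cd H *.
  have zT : `|z| <= (1 + m'.+1%:R^-1) * N (T (l, m') z).
    apply: le_trans H _; rewrite /T /= snZ_ge0 ?invr_ge0 ?(ltW c0) //.
    rewrite mulrA ler_wpM2r ?sn_ge0 // ler_pdivlMr // mulrC //.
  have ze : m'.+1%:R^-1 * N (T (l, m') z) <= e.
    apply: le_trans (_ : m'.+1%:R^-1 * `|z| <= e); first by rewrite ler_wpM2l ?invr_ge0.
    rewrite ler_pdivrMl // mulrC -ler_pdivrMl // mulrC.
    by apply: le_trans (ltW (truncnS_gt (`|z| / e))) _; rewrite ler_nat ltnS.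
  by move: ze zT; rewrite mulrDl mul1r; set a := _^-1 * _; lra.
apply: (@fpp_of_split_norm R Y Q (fun z => `|z|)) => //.
- by move=> z; rewrite -nQ => /eqP; rewrite normr_eq0 => /eqP.
- move=> u _ cu; have [|z uz] := @complete_seq R Y u.
    by move=> e /cu[n0 Hn0]; exists n0 => m n mn nn; rewrite nQ; exact: Hn0.
  by exists z => // e /uz[n0 Hn0]; exists n0 => n /Hn0; rewrite nQ.
Qed.

End DirectSum.

Theorem theorem3p8 (R : realType) (r : nat) (X : 'I_r -> completeNormedModType R)
    (psi : ('I_r -> R) -> R) :
  (forall i, uniformly_nonsquare (X i)) ->
  is_norm_Rn psi -> absolute_Rn psi -> normalized_Rn psi ->
  (strictly_monotone_Rn psi \/ r = 2%N) ->
  ns_fpp_ani (psi_sum (fun i => X i : normedModType R) psi) /\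
  ns_super_fpp_ani (psi_sum (fun i => X i : normedModType R) psi).
Proof.
move=> Xns npsi apsi n1psi _.
have [N [NE Nge Nle]] := dsum_split_norm Xns npsi apsi n1psi.
by split; [exact: dsum_fpp NE Nge Nle|exact: dsum_super_fpp NE].
Qed.
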